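(* There is an absolute constant $\varepsilon>0$ such that every $n$-vertex graph ($n\geq 3$) with average degree $d\geq 2\log\log n$ has a $64$-almost-regular subgraph with average degree at least $\varepsilon\,\frac{(d/\log\log n)^{1/4}}{(\log(d/\log\log n))^{1/2}}$. Furthermore, for every positive integer $t$ there is $\varepsilon_t>0$ such that every $n$-vertex graph ($n\geq 3$) not containing $K_{t,t}$ as a subgraph, with average degree $d\geq 2\log\log n$, has a $64$-almost-regular subgraph with average degree at least $\varepsilon_t\,\frac{(d/\log\log n)^{1/2}}{\log(d/\log\log n)}$.
   Context: Logarithms are to base $2$. A graph is $K$-almost-regular if its maximum degree is at most $K$ times its minimum degree; subgraphs are non-empty; average degree is $2e/|V|$. *)

(* Defs.v *)
From mathcomp Require Import all_boot.
From Stdlib Require Import Reals.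

Set Implicit Arguments.
Unset Strict Implicit.
Unset Printing Implicit Defensive.

Definition simple_graph (T : finType) (E : rel T) : Prop :=
  symmetric E /\ irreflexive E.

Definition log2 (x : R) : R := (ln x / ln 2)%R.

Definition is_subgraph (T : finType) (E : rel T) (S : {set T}) (F : rel T) : Prop :=
  symmetric F /\ (forall x y, F x y -> E x y) /\
  (forall x y, F x y -> (x \in S) && (y \in S)).

Definition sdeg (T : finType) (S : {set T}) (F : rel T) (v : T) : nat :=
  #|[set u in S | F v u]|.

Definition nedges (T : finType) (F : rel T) : nat :=
  #|[set A : {set T} | [exists x, exists y, F x y && (A == [set x; y])]]|.

Definition avg_deg (T : finType) (S : {set T}) (F : rel T) : R :=
  (2 * INR (nedges F) / INR #|S|)%R.

Definition almost_regular (T : finType) (K : nat) (S : {set T}) (F : rel T) : Prop :=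
  forall u v, u \in S -> v \in S -> sdeg S F u <= K * sdeg S F v.

Definition contains_Ktt (T : finType) (E : rel T) (t : nat) : Prop :=
  exists A B : {set T}, #|A| = t /\ #|B| = t /\ [disjoint A & B] /\
    (forall a b, a \in A -> b \in B -> E a b).

(* Main.v *)
(** Restrict to a bipartite subgraph of large minimum degree with sides A and B,
    |B| <= |A|, where every vertex of A keeps exactly d' neighbours. Sort the
    vertices of B by the logarithm x of their degree: each range
    2^i <= x < 2^(i+1) is cut into 2^c windows of equal width, so there are about
    2^c * loglog n levels. Cut the neighbourhood of every vertex of A inside each
    level into blocks of size k, and regard the blocks as independent stars; by
    pigeonhole some level carries many stars.

    If all degrees in that level lie within a factor 2, sampling the stars
    uniformly gives the subgraph. Otherwise the degrees lie between 2^(m-w) and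
    D = 2^m with w much smaller than m/k. As the graph is K_{t,t}-free, most stars
    contain a substar of r ~ k/t leaves whose pairwise codegrees are much smaller
    than D. Keep each leaf b with probability deg(b)/D, and keep a star if all its
    leaves survive and an additional coin makes its total survival probability
    equal to r/D. Conditioned on survival, every leaf then expects about r
    surviving stars whatever its original degree was, and Markov's inequality
    suffices.

    For the first part take r = 8t with t ~ (d/loglog n)^(1/4): if K_{t,t} does
    occur, it is itself the regular subgraph. *)
Require Import Defs.
From mathcomp Require Import all_boot all_order all_algebra.
From mathcomp Require Import zify.
From mathcomp Require ring lra.

Set Implicit Arguments.
Unset Strict Implicit.
Unset Printing Implicit Defensive.

Import Order.TTheory GRing.Theory Num.Theory.

(** * Random subsets with independently chosen elements *)

Section RandomSubset.

Local Open Scope ring_scope.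

Variables (R : realFieldType) (U : finType) (rho : U -> R).

(** Probability of the outcome [w] when each [u] is taken independently with probability [rho u]. *)
Definition weight (w : {set U}) : R :=
  \prod_u (if u \in w then rho u else 1 - rho u).

(** Expand the product of the sums [rho u + G u], which equal 1 off [S]: an outcome missing an
    element of [S] picks up the factor 0. *)
Lemma weight_superset (S : {set U}) :
  \sum_(w : {set U}) weight w * (S \subset w)%:R = \prod_(u in S) rho u.
Proof.
pose G u := if u \in S then 0 else 1 - rho u.
have -> : \prod_(u in S) rho u = \prod_u (rho u + G u).
  rewrite [LHS]big_mkcond; apply: eq_bigr => u _; rewrite /G.
  by case: ifP => _; [rewrite addr0 | rewrite addrC subrK].
rewrite bigA_distr; apply: eq_bigr => w _.
have [/subsetP Sw|/subsetPn [u uS uw]] := boolP (S \subset w).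
  rewrite mulr1; apply: eq_bigr => u _; rewrite /G.
  by case: ifP => // uw; case: ifP => // /Sw; rewrite uw.
by rewrite mulr0 (bigD1 u) //= (negbTE uw) /G uS mul0r.
Qed.

Hypothesis rho01 : forall u, 0 <= rho u <= 1.

Lemma weight_ge0 (w : {set U}) : 0 <= weight w.
Proof.
apply: prodr_ge0 => u _; have /andP [r0 r1] := rho01 u.
by case: ifP => // _; rewrite subr_ge0.
Qed.

Lemma exists_of_mean_gt0 (f : {set U} -> R) :
  0 < \sum_w weight w * f w -> exists w, 0 < f w.
Proof.
move=> mean_gt0; have [/existsP //|/existsPn f_le0] := boolP [exists w, 0 < f w].
suff : \sum_w weight w * f w <= 0 by rewrite leNgt mean_gt0.
apply: sumr_le0 => w _; apply: mulr_ge0_le0; first exact: weight_ge0.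
by rewrite leNgt f_le0.
Qed.

End RandomSubset.

(** * From density to almost-regularity *)

Section MinDegree.

Variables (T : finType) (F : rel T).
Hypothesis symF : symmetric F.

(** The degree of [v] is lost, and each neighbour of [v] loses one. *)
Lemma sum_sdeg_setD1 (S : {set T}) (v : T) : v \in S ->
  \sum_(u in S) sdeg S F u <=
    \sum_(u in S :\ v) sdeg (S :\ v) F u + 2 * sdeg S F v.
Proof.
move=> vS; rewrite (big_setD1 v vS) /= addnC.
have step u : sdeg S F u <= sdeg (S :\ v) F u + F v u.
  rewrite /sdeg (cardsD1 v [set x in S | F u x]) addnC !inE vS /= (symF u v).
  apply: leq_add => //; apply/subset_leq_card/subsetP => x.
  by rewrite !inE => /and3P [-> -> ->].
have : \sum_(u in S :\ v) sdeg S F u <=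
    \sum_(u in S :\ v) sdeg (S :\ v) F u + \sum_(u in S :\ v) F v u.
  by rewrite -big_split; apply: leq_sum => u _; exact: step.
have : \sum_(u in S :\ v) (F v u : nat) <= sdeg S F v.
  rewrite /sdeg -sum1_card big_mkcond [leqRHS]big_mkcond /=.
  by apply: leq_sum => u _; rewrite !inE; case: (u == v); case: (u \in S); case: (F v u).
lia.
Qed.

(** Delete vertices of degree at most [p / q] one at a time. The left side drops by [2 * p] and the
    right side by no more, so the strict inequality survives and the process stops before the set is
    empty. *)
Lemma min_degree_subset (p q : nat) (S : {set T}) :
  2 * p * #|S| < q * \sum_(v in S) sdeg S F v ->
  exists S' : {set T}, [/\ S' \subset S, S' != set0 &
    forall v, v \in S' -> p < q * sdeg S' F v].
Proof.
have [n] := ubnP #|S|; elim: n S => // n IHn S leSn hS.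
have [/existsP [v /andP [vS hv]]|/existsPn hmin] :=
    boolP [exists v, (v \in S) && (q * sdeg S F v <= p)].
  have cS : #|S| = #|S :\ v|.+1 by rewrite (cardsD1 v S) vS.
  have := sum_sdeg_setD1 vS; set s := \sum_(u in S) _; set s' := \sum_(u in _) _.
  rewrite -/s in hS => les.
  have hS' : 2 * p * #|S :\ v| < q * s' by rewrite cS in hS; nia.
  have [|S' [S'S S'0 degS']] := IHn (S :\ v) _ hS'; first by rewrite cS in leSn.
  by exists S'; split=> //; apply: subset_trans S'S (subsetDl _ _).
exists S; split=> //.
  by apply/eqP => S0; move: hS; rewrite S0 big_set0 cards0 !muln0.
by move=> v vS; have := hmin v; rewrite vS /= -ltnNge.
Qed.

End MinDegree.

(** The minimum degree is at least [q / 64], stated without division. Since 64 is also the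
    regularity constant, maximum degree at most [q] together with this bound already gives
    almost-regularity. *)
Definition has_almost_regular (T : finType) (E : rel T) (q : nat) : Prop :=
  exists (S : {set T}) (F : rel T), [/\ S != set0, is_subgraph E S F,
    almost_regular 64 S F & forall v, v \in S -> q <= 64 * sdeg S F v].

Lemma has_almost_regular_weaken (T : finType) (E : rel T) (q q' : nat) :
  q' <= q -> has_almost_regular E q -> has_almost_regular E q'.
Proof.
move=> le_q [S [F [S0 sub areg deg]]]; exists S, F; split=> // v vS.
exact: leq_trans le_q (deg v vS).
Qed.

(** The average degree exceeds [m / 32], so some induced subgraph has minimum degree above [m / 64],
    while the maximum stays at most [m]. *)
Lemma has_almost_regular_of_density (T : finType) (E F : rel T)
    (S : {set T}) (m : nat) :
  symmetric F -> (forall x y, F x y -> E x y) ->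
  (forall v, v \in S -> sdeg S F v <= m) ->
  2 * m * #|S| < 64 * \sum_(v in S) sdeg S F v ->
  has_almost_regular E m.
Proof.
move=> symF subF maxF dens.
have [S' [S'S S'0 minF]] := min_degree_subset symF dens.
pose F' : rel T := fun x y => [&& F x y, x \in S' & y \in S'].
have degF' v : v \in S' -> sdeg S' F' v = sdeg S' F v.
  move=> vS'; apply: eq_card => u; rewrite !inE /F' vS' /=.
  by case: (u \in S'); rewrite ?andbT.
exists S', F'; split=> //.
- split; first by move=> x y; rewrite /F' symF [(x \in _) && _]andbC.
  by split=> x y /and3P [Fxy xS yS]; [exact: subF | rewrite xS yS].
- move=> u v uS vS; rewrite !degF' //; apply: leq_trans (ltnW (minF v vS)).
  apply: leq_trans (maxF u (subsetP S'S u uS)).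
  apply/subset_leq_card/subsetP => x; rewrite !inE => /andP [xS ->].
  by rewrite (subsetP S'S).
- by move=> v vS; rewrite degF' //; apply/ltnW/minF.
Qed.

(* Star [j] has centre [pi j] and leaf set [N j]. Several stars may share a
   centre, and then their leaf sets are disjoint. *)
Definition star_family (T I : finType) (E : rel T) (J : {set I})
    (pi : I -> T) (N : I -> {set T}) (B : {set T}) : Prop :=
  [/\ forall j, j \in J -> pi j \notin B,
      forall j, j \in J -> N j \subset B,
      forall j b, j \in J -> b \in N j -> E (pi j) b &
      forall j j', j \in J -> j' \in J -> j != j' -> pi j = pi j' ->
        [disjoint N j & N j']].

Lemma sum_star_degrees (T I : finType) (J : {set I}) (N : I -> {set T})
    (B : {set T}) :
  (forall j, j \in J -> N j \subset B) ->
  \sum_(b in B) #|[set j in J | b \in N j]| = \sum_(j in J) #|N j|.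
Proof.
move=> NB; rewrite (eq_bigr (fun b => \sum_(j in J) (b \in N j))); last first.
  move=> b bB; rewrite -sum1_card big_mkcond [RHS]big_mkcond /=.
  by apply: eq_bigr => j _; rewrite inE; case: (j \in J); case: (b \in N j).
rewrite exchange_big /=; apply: eq_bigr => j jJ.
rewrite -sum1_card big_mkcond [RHS]big_mkcond /=; apply: eq_bigr => b _.
by case bN: (b \in N j); rewrite ?if_same // (subsetP (NB j jJ)).
Qed.

(** With distinct centres, the union of the stars is a bipartite graph whose degrees are the star
    sizes on one side and the numbers of stars through a leaf on the other. Its degree sum is twice
    the total star size, which absorbs the factor 2 of the density condition. *)
Lemma has_almost_regular_of_stars (T I : finType) (E : rel T) (J : {set I})
    (pi : I -> T) (N : I -> {set T}) (B : {set T}) (m : nat) :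
  symmetric E -> star_family E J pi N B -> {in J &, injective pi} ->
  (forall j, j \in J -> #|N j| <= m) ->
  (forall b, b \in B -> #|[set j in J | b \in N j]| <= m) ->
  m * (#|J| + #|B|) < 64 * \sum_(j in J) #|N j| ->
  has_almost_regular E m.
Proof.
move=> symE [piB NB NE _] inj_pi degJ degB dens.
pose F : rel T := fun x y => [exists j in J,
  (x == pi j) && (y \in N j) || (y == pi j) && (x \in N j)].
pose S := pi @: J :|: B.
have symF : symmetric F.
  by move=> x y; apply: eq_existsb => j; rewrite orbC.
have Fpi j : j \in J -> [set u in S | F (pi j) u] = N j.
  move=> jJ; apply/setP => u; rewrite !inE; apply/andP/idP.
    case=> _ /existsP [i /andP [iJ /orP []/andP []]].
      by move=> /eqP /inj_pi -> // ->.
    by move=> _ /(subsetP (NB i iJ)) ; rewrite (negbTE (piB j jJ)).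
  move=> uN; rewrite (subsetP (NB j jJ)) // orbT; split=> //.
  by apply/existsP; exists j; rewrite jJ eqxx uN.
have FB b : b \in B -> [set u in S | F b u] = pi @: [set j in J | b \in N j].
  move=> bB; apply/setP => u; rewrite !inE; apply/andP/imsetP.
    case=> _ /existsP [i /andP [iJ /orP []/andP []]].
      by move=> /eqP bi; rewrite bi (negbTE (piB i iJ)) in bB.
    by move=> /eqP -> bN; exists i => //; rewrite inE iJ.
  case=> j; rewrite inE => /andP [jJ bN] ->; rewrite imset_f //; split=> //.
  by apply/existsP; exists j; rewrite jJ eqxx bN /= orbT.
have cardFB b : b \in B -> sdeg S F b = #|[set j in J | b \in N j]|.
  move=> bB; rewrite /sdeg FB // card_in_imset // => i j; rewrite !inE.
  by move=> /andP [iJ _] /andP [jJ _]; exact: inj_pi.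
apply: (has_almost_regular_of_density (F := F) (S := S)) => //.
- move=> x y /existsP [j /andP [jJ /orP []/andP [/eqP -> ]]]; first exact: NE.
  by rewrite symE; exact: NE.
- move=> v; rewrite inE => /orP [/imsetP [j jJ ->]|vB].
    by rewrite /sdeg Fpi // degJ.
  by rewrite cardFB // degB.
have disj : [disjoint pi @: J & B].
  rewrite disjoint_subset; apply/subsetP => _ /imsetP [j jJ ->].
  by rewrite inE piB.
rewrite (eq_bigl [in [predU pi @: J & B]]); last by move=> v; rewrite !inE.
rewrite bigU //= big_imset //=.
have -> : \sum_(j in J) sdeg S F (pi j) = \sum_(j in J) #|N j|.
  by apply: eq_bigr => j jJ; rewrite /sdeg Fpi.
have -> : \sum_(b in B) sdeg S F b = \sum_(j in J) #|N j|.
  by rewrite -(sum_star_degrees NB); apply: eq_bigr.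
rewrite cardsU disjoint_setI0 // cards0 subn0 card_in_imset //.
by move: dens; lia.
Qed.

(** * Linearity of expectation *)

Section Mean.

Local Open Scope ring_scope.

Variables (R : realFieldType) (U : finType) (rho : U -> R).

Definition mean (f : {set U} -> R) : R := \sum_w weight rho w * f w.

Lemma meanB f g : mean (fun w => f w - g w) = mean f - mean g.
Proof. by rewrite /mean -sumrB; apply: eq_bigr => w _; rewrite mulrBr. Qed.

Lemma meanZ c f : mean (fun w => c * f w) = c * mean f.
Proof. by rewrite /mean mulr_sumr; apply: eq_bigr => w _; rewrite mulrCA. Qed.

Lemma mean_sum (K : finType) (P : pred K) (f : K -> {set U} -> R) :
  mean (fun w => \sum_(i | P i) f i w) = \sum_(i | P i) mean (f i).
Proof.
rewrite /mean exchange_big /=.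
by apply: eq_bigr => w _; rewrite mulr_sumr.
Qed.

Lemma mean_superset (S : {set U}) :
  mean (fun w => (S \subset w)%:R) = \prod_(u in S) rho u.
Proof. exact: weight_superset. Qed.

End Mean.

(** * Random sampling of a star family *)

Section StarSampling.

Import mathcomp.algebra_tactics.ring mathcomp.algebra_tactics.lra.

Local Open Scope ring_scope.

Variables (R : realFieldType) (T I : finType) (E : rel T) (J : {set I}).
Variables (pi : I -> T) (N : I -> {set T}) (B : {set T}) (r m : nat).
Variables (p : T -> R) (P0 X Y : R).

Hypothesis symE : symmetric E.
Hypothesis stars : star_family E J pi N B.
Hypothesis cardN : forall j, j \in J -> #|N j| = r.
Hypothesis le_rm : (r <= m)%N.
Hypothesis m_gt0 : (0 < m)%N.
Hypothesis p01 : forall b, 0 < p b <= 1.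
Hypothesis P0_gt0 : 0 < P0.
Hypothesis P0_le : forall j, j \in J -> P0 <= \prod_(b in N j) p b.
Hypothesis codegree_le : forall j b, j \in J -> b \in N j ->
  \sum_(j' in J | (j' != j) && (b \in N j'))
     P0 / \prod_(c in N j :&: N j') p c <= X.
Hypothesis siblings_le : forall j, j \in J ->
  #|[set j' in J | pi j' == pi j]|%:R * P0 <= Y.
Hypothesis density : m%:R * (#|J|%:R * P0 + \sum_(b in B) p b) <
  64%:R * (r%:R * #|J|%:R * P0 * (1 - Y - X / m%:R)).

Let prodp_gt0 (S : {set T}) : 0 < \prod_(b in S) p b.
Proof. by apply: prodr_gt0 => b _; have /andP [] := p01 b. Qed.

(* Star [j] is alive when its leaves all survive and its own coin [q j] comes
   up heads, so every star is alive with the same probability [P0]. *)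
Let q (j : I) : R := if j \in J then P0 / \prod_(b in N j) p b else 0.

(** One sample space holds both kinds of independent choices: left elements are surviving leaves,
    right elements are the coins of the stars. *)
Let rho (u : T + I) : R := match u with inl b => p b | inr j => q j end.

Let rho01 u : 0 <= rho u <= 1.
Proof.
case: u => [b|j] /=; first by have /andP [/ltW -> ->] := p01 b.
rewrite /q; case: ifP => jJ; last by rewrite lexx ler01.
by rewrite ltW ?divr_gt0 //= ler_pdivrMr // mul1r P0_le.
Qed.

Let lift_set (S : {set T}) (K : {set I}) : {set T + I} :=
  [set u | match u with inl b => b \in S | inr j => j \in K end].

Let prod_lift_set S K : \prod_(u in lift_set S K) rho u =
  (\prod_(b in S) p b) * \prod_(j in K) q j.
Proof.
rewrite big_mkcond big_sumType /= [in RHS]big_mkcond /=; congr (_ * _).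
  by apply: eq_bigr => b _; rewrite inE.
by rewrite [RHS]big_mkcond; apply: eq_bigr => j _; rewrite inE.
Qed.

Let lift_setU S S' K K' :
  lift_set (S :|: S') (K :|: K') = lift_set S K :|: lift_set S' K'.
Proof. by apply/setP => -[b|j]; rewrite !inE. Qed.

Let alive (w : {set T + I}) (j : I) : bool := lift_set (N j) [set j] \subset w.

Let mean_alive j : j \in J -> mean rho (fun w => (alive w j)%:R) = P0.
Proof.
move=> jJ; rewrite mean_superset prod_lift_set big_set1 /q jJ.
by rewrite mulrC divfK // lt0r_neq0.
Qed.

(** The shared leaves have to survive only once, so their survival probability is divided out of
    [P0 * P0]. *)
Let mean_alive2 j j' : j \in J -> j' \in J -> j' != j ->
  mean rho (fun w => (alive w j)%:R * (alive w j')%:R) =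
  P0 * (P0 / \prod_(c in N j :&: N j') p c).
Proof.
move=> jJ j'J ne; rewrite /mean.
transitivity (mean rho (fun w =>
    (lift_set (N j :|: N j') ([set j] :|: [set j']) \subset w)%:R)).
  by apply: eq_bigr => w _; rewrite lift_setU subUset -natrM mulnb.
rewrite mean_superset prod_lift_set big_setU1 ?inE 1?eq_sym //= big_set1 /q jJ j'J.
have eqU : \prod_(b in N j :|: N j') p b * \prod_(b in N j :&: N j') p b =
    \prod_(b in N j) p b * \prod_(b in N j') p b.
  rewrite [X in _ = _ * X](big_setID (N j)) /= [N j' :&: _]setIC.
  rewrite [X in X * _](big_setID (N j)) /= setUK setDUl setDv set0U.
  by ring.
have /lt0r_neq0 := prodp_gt0 (N j); have /lt0r_neq0 := prodp_gt0 (N j').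
have /lt0r_neq0 := prodp_gt0 (N j :&: N j').
move: eqU; move: (\prod_(b in N j :|: N j') p b) => u.
move: (\prod_(b in N j :&: N j') p b) (\prod_(b in N j) p b) (\prod_(b in N j') p b).
move=> i a b eqU i0 b0 a0.
have -> : u = a * b / i by rewrite -eqU mulfK.
by field; rewrite i0 a0 b0.
Qed.

Let sib (j : I) : pred I := [pred j' in J | (j' != j) && (pi j' == pi j)].
Let cob (j : I) (b : T) : pred I := [pred j' in J | (j' != j) && (b \in N j')].

(** A lower bound for the indicator that the edge from star [j] to leaf [b] is kept. It involves
    only pairs of stars, so its mean is computable: the first sum is a union bound over stars with
    the same centre, the second is Markov's inequality for the load of [b]. *)
Let edge_bound w j b : R := (alive w j)%:R
  - \sum_(j' | sib j j') (alive w j)%:R * (alive w j')%:R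
  - m%:R^-1 * \sum_(j' | cob j b j') (alive w j)%:R * (alive w j')%:R.

Let mean_edge_bound j b : j \in J -> b \in N j ->
  P0 * (1 - Y - X / m%:R) <= mean rho (fun w => edge_bound w j b).
Proof.
move=> jJ bN; have m0 : 0 < m%:R :> R by rewrite ltr0n.
rewrite /edge_bound !meanB meanZ !mean_sum mean_alive //.
rewrite mulrBr mulrBr mulr1.
apply: lerB; first apply: lerB => //.
(* Stars with a common centre have disjoint leaf sets, so they are alive independently. *)
- rewrite (eq_bigr (fun=> P0 * P0)); last first.
    move=> j' /and3P [j'J ne /eqP epi]; rewrite mean_alive2 //.
    have [_ _ _ disj] := stars.
    have := disj j' j j'J jJ ne epi; rewrite disjoint_sym => /disjoint_setI0 ->.
    by rewrite big_set0 divr1.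
  rewrite sumr_const -mulr_natr -mulrA ler_pM2l // mulrC.
  apply: le_trans (siblings_le jJ); rewrite ler_pM2r // ler_nat.
  apply/subset_leq_card/subsetP => i; rewrite !inE.
  by move=> /and3P [-> _ ->].
- rewrite [leRHS]mulrA [leRHS]mulrC ler_pM2l ?invr_gt0 //.
  rewrite (eq_bigr (fun j' => P0 * (P0 / \prod_(c in N j :&: N j') p c))); last first.
    by move=> j' /and3P [j'J ne _]; rewrite mean_alive2.
  by rewrite -mulr_sumr ler_pM2l //; apply: codegree_le.
Qed.

(** Requiring that no other star at the same centre is alive makes the centres of the survivors
    distinct. *)
Let survivors (w : {set T + I}) : {set I} :=
  [set j in J | alive w j & ~~ [exists j', sib j j' && alive w j']].

Let leaves (w : {set T + I}) : {set T} := [set b in B | (inl b \in w)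
  && (#|[set j in J | alive w j & b \in N j]| <= m)%N].

Let edge_bound_le w j b : j \in J -> b \in N j ->
  edge_bound w j b <= ((j \in survivors w) && (b \in leaves w))%:R.
Proof.
move=> jJ bN; have m0 : 0 < m%:R :> R by rewrite ltr0n.
have sum_alive (Q : pred I) :
    \sum_(j' | Q j') (alive w j')%:R = #|[set j' | Q j' && alive w j']|%:R :> R.
  rewrite -sum1_card natr_sum [LHS]big_mkcond [RHS]big_mkcond /=.
  by apply: eq_bigr => i _; rewrite inE; case: (Q i); case: alive.
rewrite /edge_bound -!mulr_sumr !sum_alive.
have [al|_] := boolP (alive w j); last first.
  by rewrite !mul0r mulr0 !subr0 ler0n.
rewrite !mul1r.
set s := #|_|; set t := #|_|.
have t0 : 0 <= m%:R^-1 * t%:R :> R by rewrite mulr_ge0 ?ler0n ?invr_ge0.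
have s0 : 0 <= s%:R :> R by exact: ler0n.
have [js|js] /= := boolP (j \in survivors w); last first.
  have s1 : 1 <= s%:R :> R.
    rewrite ler1n card_gt0; apply/set0Pn; move: js.
    rewrite inE jJ al /= negbK => /existsP [j' hj']; exists j'.
    by rewrite inE.
  by move: s1 t0; lra.
have [bl|bl] /= := boolP (b \in leaves w).
  by move: s0 t0; lra.
have bB : b \in B by have [_ NB _ _] := stars; exact: (subsetP (NB j jJ)).
have bw : inl b \in w by apply: (subsetP al); rewrite inE.
(* A rejected leaf lies in more than [m] alive stars; [j] is one of them, so at least [m] others
   remain. *)
have : (m <= t)%N.
  move: bl; rewrite inE bB bw /= -ltnNge (cardsD1 j) inE jJ al bN /= add1n ltnS.
  move=> /leq_trans -> //; apply/subset_leq_card/subsetP => i.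
  by rewrite /cob !inE => /and4P [-> -> -> ->].
rewrite -(ler_nat R) -(ler_pM2l (x := m%:R^-1)) ?invr_gt0 // mulVf ?lt0r_neq0 //.
by move: s0; lra.
Qed.

(** Given that [j] is alive, [X] bounds the expected number of other alive stars at a leaf of [j],
    and [Y] the probability that its centre has a second alive star. Hence an edge is kept with
    probability at least [P0 * (1 - Y - X / m)], and [density] compares the expected numbers of
    edges and vertices. *)
Lemma has_almost_regular_sampling : has_almost_regular E m.
Proof.
have [piB NB NE disj] := stars.
pose f w := \sum_(j in J) \sum_(b in N j) edge_bound w j b.
pose nb (w : {set T + I}) : R :=
  \sum_(b in B) (lift_set [set b] set0 \subset w)%:R.
pose na (w : {set T + I}) : R := \sum_(j in J) (alive w j)%:R.
(* Edges are counted from below and vertices from above, so a positive value gives the density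
   condition for the surviving stars. *)
have [w] : exists w, 0 < 64%:R * f w - m%:R * na w - m%:R * nb w.
  apply: (exists_of_mean_gt0 rho01).
  rewrite -/(mean _ _) !meanB !meanZ /f /na /nb.
  rewrite !mean_sum (eq_bigr (fun=> P0) mean_alive) sumr_const -[P0 *+ _]mulr_natl.
  under [X in _ - _ * X]eq_bigr => b bB.
    rewrite mean_superset prod_lift_set big_set1 big_set0 mulr1; over.
  rewrite -addrA -opprD -mulrDr subr_gt0; apply: lt_le_trans density _.
  rewrite ler_pM2l ?ltr0n //.
  rewrite [_ * #|J|%:R]mulrC -!mulrA mulr_natl -sumr_const; apply: ler_sum => j jJ.
  rewrite mean_sum mulr_natl -(cardN jJ) -sumr_const; apply: ler_sum => b bN.
  exact: mean_edge_bound.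
move=> pos.
have alE j : j \in survivors w -> j \in J /\ alive w j.
  by rewrite inE => /andP [-> /andP [->]].
apply: (has_almost_regular_of_stars (I := I) (J := survivors w) (pi := pi)
  (N := fun j => N j :&: leaves w) (B := leaves w)) => //.
- split.
  + by move=> j /alE [/piB jB _]; rewrite inE (negbTE jB).
  + by move=> j _; exact: subsetIr.
  + by move=> j b /alE [jJ _]; rewrite inE => /andP [bN _]; exact: NE.
  + move=> j j' /alE [jJ _] /alE [j'J _] ne epi.
    apply: disjointWl (subsetIl _ _) _; apply: disjointWr (subsetIl _ _) _.
    exact: disj.
- move=> j j' js /alE [j'J al'] epi; apply/eqP; rewrite eq_sym.
  move: js; rewrite inE => /andP [jJ /andP [al /existsPn /(_ j')]].
  by rewrite /sib /= j'J al' epi eqxx !andbT negbK.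
- move=> j /alE [jJ _]; apply: leq_trans le_rm; rewrite -(cardN jJ).
  exact/subset_leq_card/subsetIl.
- move=> b; rewrite inE => /andP [bB /andP [_ degb]]; apply: leq_trans degb.
  apply/subset_leq_card/subsetP => j; rewrite !inE.
  by move=> /andP [/andP [-> /andP [-> _]] /andP [-> _]].
rewrite -(ltr_nat R) !natrM natrD.
have le_na : #|survivors w|%:R <= na w.
  rewrite -sum1_card natr_sum /na big_mkcond [leRHS]big_mkcond /=.
  apply: ler_sum => j _; rewrite inE.
  by case: (j \in J); case: (alive w j) => //=; case: existsP => //= _; rewrite ler01.
have le_nb : #|leaves w|%:R <= nb w.
  rewrite -sum1_card natr_sum /nb big_mkcond [leRHS]big_mkcond /=.
  apply: ler_sum => b _; rewrite inE.
  have -> : (lift_set [set b] set0 \subset w) = (inl b \in w).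
    apply/subsetP/idP => [|bw]; first by apply; rewrite !inE.
    by case=> [c|j]; rewrite !inE // => /eqP ->.
  by case: (b \in B); case: (inl b \in w) => //=; case: leqP => //= _; rewrite ler01.
have le_f : f w <= (\sum_(j in survivors w) #|N j :&: leaves w|)%:R.
  rewrite natr_sum /f big_mkcond [leRHS]big_mkcond /=; apply: ler_sum => j _.
  have [jJ|jJ] := boolP (j \in J); last by rewrite inE (negbTE jJ).
  apply: le_trans (ler_sum _ (fun b bN => edge_bound_le w jJ bN)) _.
  case: (j \in survivors w) => /=; last by rewrite big1.
  rewrite -sum1_card natr_sum big_mkcond [leRHS]big_mkcond /=.
  by apply: ler_sum => b _; rewrite !inE; case: (b \in N j) => //=; case: (_ && _).
have m0 : 0 < m%:R :> R by rewrite ltr0n.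
move: pos; rewrite -addrA -opprD -mulrDr subr_gt0.
have : m%:R * (#|survivors w|%:R + #|leaves w|%:R) <= m%:R * (na w + nb w).
  by rewrite ler_pM2l // lerD.
move: le_f; lra.
Qed.

End StarSampling.

(** * Levels of nearly constant degree *)

Section NarrowLevel.

Import mathcomp.algebra_tactics.ring mathcomp.algebra_tactics.lra.

Local Open Scope ring_scope.

(** The average degree on [B] is a constant fraction of the bound [D], so uniform sampling works:
    keep all leaves and take each star with probability [k / (8 * D)]. Stars at the same centre cost
    at most [3 / 8] and Markov costs [1 / 8], so at least half of the expected edges remain. *)
Lemma has_almost_regular_narrow (T I : finType) (E : rel T) (J : {set I})
    (pi : I -> T) (N : I -> {set T}) (B : {set T}) (k D d : nat) :
  symmetric E -> star_family E J pi N B ->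
  (0 < k)%N -> (0 < #|J|)%N -> (forall j, j \in J -> #|N j| = k) ->
  (forall b, b \in B -> (#|[set j in J | b \in N j]| <= D)%N) ->
  (forall j, j \in J -> (k * #|[set j' in J | pi j' == pi j]| <= d)%N) ->
  (d <= 3 * D)%N -> (5 * #|B| * D <= 16 * k * #|J|)%N ->
  has_almost_regular E k.
Proof.
move=> symE stars k0 J0 cardN degB sib leD dens.
have [j0 j0J] : exists j, j \in J by apply/set0Pn; rewrite -card_gt0.
have kd : (k <= d)%N.
  apply: leq_trans (sib j0 j0J); rewrite leq_pmulr // card_gt0.
  by apply/set0Pn; exists j0; rewrite inE j0J eqxx.
have D0 : (0 < D)%N by lia.
have Dq : 0 < D%:R :> rat by rewrite ltr0n.
have kq : 0 < k%:R :> rat by rewrite ltr0n.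
have Jq : 0 < #|J|%:R :> rat by rewrite ltr0n.
have leDq : d%:R <= 3 * D%:R :> rat by rewrite -natrM ler_nat.
have kdq : k%:R <= d%:R :> rat by rewrite ler_nat.
have densq : 5 * #|B|%:R * D%:R <= 16 * k%:R * #|J|%:R :> rat.
  by rewrite -!natrM ler_nat.
have D8 : 0 < 8 * D%:R :> rat by move: Dq; lra.
have P0_gt0 : 0 < k%:R / (8 * D%:R) :> rat by exact: divr_gt0 kq D8.
have p01 (b : T) : (0 : rat) < (1 : rat) <= 1 by rewrite ltr01 lexx.
set P := k%:R / (8 * D%:R) in P0_gt0.
have PD : P * D%:R = k%:R / 8 by rewrite /P; field; rewrite lt0r_neq0.
have PDk : 8 * (P * D%:R) = k%:R by rewrite PD; field.
set X : rat := k%:R / 8 in PD; set Y : rat := 3 / 8.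
apply: (@has_almost_regular_sampling rat T I E J pi N B k k (fun=> 1)
  P X Y symE stars cardN (leqnn k) k0 p01 P0_gt0) => {p01}.
- move=> j jJ; rewrite prodr_const expr1n /P ler_pdivrMr; last exact: D8.
  by move: leDq kdq Dq; lra.
- move=> j b jJ bN; have [_ NB _ _] := stars.
  rewrite (eq_bigr (fun=> P)); last first.
    by move=> j' _; rewrite prodr_const expr1n divr1.
  rewrite sumr_const -mulr_natr -PD (ler_pM2l P0_gt0) ler_nat.
  apply: leq_trans (degB b (subsetP (NB j jJ) b bN)).
  by apply/subset_leq_card/subsetP => i; rewrite !inE => /and3P [-> _ ->].
- move=> j jJ; have := sib j jJ; rewrite -(ler_nat rat) natrM => hs.
  rewrite /P mulrA ler_pdivrMr; last exact: D8.
  rewrite mulrC.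
  by rewrite /Y; move: leDq hs; lra.
have -> : 1 - Y - X / k%:R = 1 / 2 by rewrite /Y /X; field; rewrite lt0r_neq0.
rewrite sumr_const -/(#|B|%:R).
rewrite [ltRHS](_ : _ = k%:R * (32 * (#|J|%:R * P))); last by field.
rewrite ltr_pM2l; last exact: kq.
have : 5 * #|B|%:R <= 128 * (#|J|%:R * P).
  rewrite -(ler_pM2r Dq); apply: le_trans densq _.
  by rewrite -PDk; rewrite le_eqVlt; apply/orP; left; apply/eqP; ring.
have : 0 < #|J|%:R * P by rewrite mulr_gt0.
by lra.
Qed.

End NarrowLevel.

(** * Greedy selection, pruning and counting stars without [K_{t,t}] *)

(** Greedy choice: each chosen element removes itself and at most [t - 1] neighbours. *)
Lemma independent_subset (T : finType) (Q : rel T) (t r : nat) (U : {set T}) :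
  symmetric Q -> 0 < t -> r * t <= #|U| ->
  (forall x, x \in U -> #|[set y in U | Q x y]| < t) ->
  exists V : {set T}, [/\ V \subset U, #|V| = r &
    forall x y, x \in V -> y \in V -> x != y -> ~~ Q x y].
Proof.
move=> symQ t0; elim: r U => [|r IHr] U leU degU.
  by exists set0; split; rewrite ?sub0set ?cards0 // => x y; rewrite inE.
have [x xU] : exists x, x \in U by apply/set0Pn; rewrite -card_gt0; lia.
pose K := [set y in U | Q x y].
pose U1 := (U :\ x) :\: K.
have U1U : U1 \subset U by apply/subsetP => y; rewrite !inE => /and3P [].
have leU1 : r * t <= #|U1|.
  have := cardsD (U :\ x) K; rewrite -/U1.
  have := subset_leq_card (subsetIr (U :\ x) K).
  by have := degU x xU; have := cardsD1 x U; rewrite -/K xU; lia.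
have [y yU1|V [VU1 cV indV]] := IHr U1 leU1.
  apply: leq_ltn_trans (degU y (subsetP U1U y yU1)).
  apply/subset_leq_card/subsetP => z; rewrite !inE.
  by move=> /andP [/and3P [_ _ ->] ->].
have notQ y : y \in V -> ~~ Q x y.
  move=> /(subsetP VU1); rewrite !inE => /andP [nQ /andP [_ yU]].
  by move: nQ; rewrite yU.
have xV : x \notin V.
  by apply/negP => /(subsetP VU1); rewrite !inE eqxx andbF.
exists (x |: V); split.
- by rewrite subUset sub1set xU (subset_trans VU1).
- by rewrite cardsU1 xV cV.
move=> y z; rewrite !inE => /orP [/eqP ->|yV] /orP [/eqP ->|zV]; rewrite ?eqxx //.
- by move=> _; exact: notQ.
- by move=> _; rewrite symQ notQ.
- exact: indV.
Qed.

(** Delete a leaf of degree below [h] together with all stars through it. Fewer than [h] stars go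
    with each leaf, so [#|B| * h < #|J|] persists and some star is left. *)
Lemma prune_stars (T I : finType) (J : {set I}) (N : I -> {set T})
    (B : {set T}) (h : nat) :
  (forall j, j \in J -> N j \subset B) -> #|B| * h < #|J| ->
  exists (J' : {set I}) (B' : {set T}),
    [/\ J' \subset J, B' \subset B, 0 < #|J'|,
        forall j, j \in J' -> N j \subset B' &
        forall b, b \in B' -> h <= #|[set j in J' | b \in N j]|].
Proof.
have [n] := ubnP #|B|; elim: n B J => // n IHn B J leBn NB leJ.
have [/existsP [b /andP [bB hb]]|/existsPn hmin] :=
    boolP [exists b, (b \in B) && (#|[set j in J | b \in N j]| < h)].
  pose J1 := [set j in J | b \notin N j].
  have cB : #|B| = #|B :\ b|.+1 by rewrite (cardsD1 b B) bB.
  have cJ : #|J| = #|[set j in J | b \in N j]| + #|J1|.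
    rewrite -(cardsID [set j in J | b \in N j] J); congr (_ + _).
      by apply: eq_card => j; rewrite !inE; case: (j \in J).
    by apply: eq_card => j; rewrite !inE; case: (j \in J) => //=; rewrite andbT.
  have [|||J' [B' [J'J B'B J'0 NB' deg]]] := IHn (B :\ b) J1.
  - by rewrite cB in leBn.
  - move=> j; rewrite inE => /andP [jJ bN].
    by rewrite subsetD1 NB.
  - by rewrite cB in leJ; nia.
  exists J', B'; split=> //; last exact: subset_trans B'B (subsetDl _ _).
  by apply: subset_trans J'J _; apply/subsetP => j; rewrite inE => /andP [].
exists J, B; split=> //; first by lia.
by move=> b bB; have := hmin b; rewrite bB /= -leqNgt.
Qed.

Lemma bin_le_exp (n t : nat) : 'C(n, t) <= n ^ t.
Proof.
elim: t n => [|t IHt] n; first by rewrite bin0.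
have := mul_bin_diag n t; have := IHt n.-1.
have : n.-1 ^ t <= n ^ t by case: (t) => // t'; rewrite leq_exp2r // leq_pred.
by rewrite expnS; nia.
Qed.

Lemma subset_of_card (T : finType) (A : {set T}) (t : nat) :
  t <= #|A| -> exists2 S : {set T}, S \subset A & #|S| = t.
Proof.
move=> leA; exists [set x in take t (enum A)].
  by apply/subsetP => x; rewrite inE => /mem_take; rewrite mem_enum.
rewrite cardsE (card_uniqP _) ?take_uniq ?enum_uniq // size_take -cardE.
by case: ltngtP leA.
Qed.

(** Stars with a common leaf have distinct centres, so [t] stars containing [S] would give a
    [K_{t,t}] between their centres and [S]. *)
Lemma common_stars_lt (T I : finType) (E : rel T) (J : {set I})
    (pi : I -> T) (N : I -> {set T}) (B : {set T}) (t : nat) (S : {set T}) :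
  0 < t -> ~ contains_Ktt E t -> star_family E J pi N B -> #|S| = t ->
  #|[set j in J | S \subset N j]| < t.
Proof.
move=> t0 noK [piB NB NE disj] cS; rewrite ltnNge; apply/negP => leK.
have [s sS] : exists s, s \in S by apply/set0Pn; rewrite -card_gt0 cS.
set K := [set j in J | _] in leK.
have KE j : j \in K -> j \in J /\ S \subset N j by rewrite inE => /andP.
have inj : {in K &, injective pi}.
  move=> i j /KE [iJ /subsetP Si] /KE [jJ /subsetP Sj] epi.
  apply/eqP; apply: contraT => ne.
  have /disjoint_setI0 /setP /(_ s) := disj i j iJ jJ ne epi.
  by rewrite !inE Si // Sj.
have [A AK cA] : exists2 A : {set T}, A \subset pi @: K & #|A| = t.
  by apply: subset_of_card; rewrite card_in_imset.
apply: noK; exists A, S; split=> //; split=> //; split.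
  rewrite disjoint_subset; apply/subsetP => a /(subsetP AK) /imsetP [j /KE [jJ Sj] ->].
  rewrite inE; apply: contra (piB j jJ) => /(subsetP Sj).
  exact: (subsetP (NB j jJ)).
move=> a b /(subsetP AK) /imsetP [j /KE [jJ /subsetP Sj] ->] /Sj.
exact: NE.
Qed.

(** * Sampling with survival probability proportional to the degree *)

Section SmallCodegree.

Import mathcomp.algebra_tactics.ring mathcomp.algebra_tactics.lra.

Local Open Scope ring_scope.

Variables (T I : finType) (E : rel T) (J : {set I}) (pi : I -> T).
Variables (N : I -> {set T}) (B : {set T}) (r D Q W h : nat).

Let deg (b : T) : nat := #|[set j in J | b \in N j]|.
Let codeg (b c : T) : nat := #|[set j in J | (b \in N j) && (c \in N j)]|.

Hypothesis symE : symmetric E.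
Hypothesis stars : star_family E J pi N B.
Hypothesis r_gt0 : (0 < r)%N.
Hypothesis D_gt0 : (0 < D)%N.
Hypothesis J_gt0 : (0 < #|J|)%N.
Hypothesis cardN : forall j, j \in J -> #|N j| = r.
Hypothesis deg_bounds : forall b, b \in B -> (h <= deg b <= D)%N.
Hypothesis codeg_lt : forall j b c, j \in J -> b \in N j -> c \in N j ->
  b != c -> (Q * codeg b c < D)%N.
Hypothesis siblings_le : forall j, j \in J ->
  (4 * r * #|[set j' in J | pi j' == pi j]| <= D)%N.
Hypothesis le_DWh : (D <= W * h)%N.
Hypothesis le_rWQ : (r * W ^ r <= Q)%N.
Hypothesis le_QD : (Q <= D)%N.

(** Off [B] the default 1 keeps the probability positive. *)
Let p (b : T) : rat := if b \in B then (deg b)%:R / D%:R else 1.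
Let P0 : rat := r%:R / D%:R.

Let Dq : 0 < D%:R :> rat. Proof. by rewrite ltr0n. Qed.
Let rq : 0 < r%:R :> rat. Proof. by rewrite ltr0n. Qed.
Let W_gt0 : (0 < W)%N. 
Proof.
rewrite lt0n; apply: contraTneq le_DWh => ->.
by rewrite mul0n -ltnNge.
Qed.
Let Wq : 0 < W%:R :> rat. Proof. by rewrite ltr0n. Qed.
Let P0_gt0 : 0 < P0. Proof. by rewrite divr_gt0. Qed.

Let p_ge b : W%:R^-1 <= p b.
Proof.
rewrite /p; case: ifP => bB; last by rewrite invf_le1 // ler1n.
have /andP [hb _] := deg_bounds bB.
rewrite ler_pdivlMr // mulrC ler_pdivrMr // -natrM ler_nat mulnC.
by apply: leq_trans le_DWh _; rewrite leq_mul2l hb orbT.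
Qed.

Let p01 b : 0 < p b <= 1.
Proof.
rewrite (lt_le_trans _ (p_ge b)) ?invr_gt0 //=.
rewrite /p; case: ifP => bB //; have /andP [_ hb] := deg_bounds bB.
by rewrite ler_pdivrMr // mul1r ler_nat.
Qed.

Let prod_p_ge (S : {set T}) : (#|S| <= r)%N ->
  (W ^ r)%:R^-1 <= \prod_(b in S) p b.
Proof.
move=> cS; apply: le_trans (_ : \prod_(b in S) W%:R^-1 <= _); last first.
  by apply: ler_prod => b _; rewrite p_ge invr_ge0 ler0n.
rewrite prodr_const natrX exprVn lef_pV2 ?posrE ?exprn_gt0 //.
by rewrite ler_weXn2l // ler1n.
Qed.

Let prod_p_gt0 (S : {set T}) : 0 < \prod_(b in S) p b.
Proof. by apply: prodr_gt0 => b _; have /andP [] := p01 b. Qed.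

(** If the two stars meet only in [b], the left side is exactly [r / deg b]. Otherwise it is bounded
    crudely through [p >= 1 / W] and charged to another common leaf [c]. *)
Let term_le j j' b : j \in J -> j' \in J -> b \in N j -> b \in N j' ->
  P0 / \prod_(c in N j :&: N j') p c <=
    r%:R / (deg b)%:R + \sum_(c in N j :\ b) (c \in N j')%:R * (P0 * (W ^ r)%:R).
Proof.
move=> jJ j'J bj bj'.
have bB : b \in B by have [_ NB _ _] := stars; exact: (subsetP (NB j jJ)).
have PW0 : 0 <= P0 * (W ^ r)%:R by rewrite mulr_ge0 ?ler0n // ltW.
have sum0 : 0 <= \sum_(c in N j :\ b) (c \in N j')%:R * (P0 * (W ^ r)%:R).
  by apply: sumr_ge0 => c _; rewrite mulr_ge0 ?ler0n.
have [/existsP [c /andP [cN cj']]|/existsPn no_c] :=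
    boolP [exists c, (c \in N j :\ b) && (c \in N j')].
  apply: ler_wpDl; first by rewrite divr_ge0 ?ler0n.
  rewrite [leRHS](bigD1 c) //= cj' mul1r -[leLHS]addr0; apply: lerD.
    rewrite ler_pM2l // -[leRHS]invrK lef_pV2 ?posrE ?invr_gt0 //; last first.
      by rewrite ltr0n expn_gt0 W_gt0.
    by apply: prod_p_ge; rewrite -(cardN jJ); apply/subset_leq_card/subsetIl.
  by apply: sumr_ge0 => c' _; rewrite mulr_ge0 ?ler0n.
apply: ler_wpDr => //.
have -> : N j :&: N j' = [set b].
  apply/setP => c; rewrite !inE; have := no_c c; rewrite !inE.
  by case: eqVneq => [->|_] /=; [rewrite bj bj' | move/negbTE].
rewrite big_set1 /p bB /P0.
have d0 : (deg b)%:R != 0 :> rat.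
  rewrite pnatr_eq0 -lt0n card_gt0; apply/set0Pn; exists j.
  by rewrite inE jJ bj.
by rewrite le_eqVlt; apply/orP; left; apply/eqP; field; rewrite d0 lt0r_neq0.
Qed.

(** The load of a leaf has conditional mean at most [2 * r]: one [r] from stars meeting [j] in that
    leaf only, another from stars sharing a further leaf. Against the cap [8 * r] Markov loses
    [1 / 4], and stars at the same centre lose another [1 / 4]. *)
Lemma has_almost_regular_small_codegree : has_almost_regular E (8 * r).
Proof.
have [piB NB NE disj] := stars.
set X : rat := 2 * r%:R; set Y : rat := 1 / 4.
apply: (@has_almost_regular_sampling rat T I E J pi N B r (8 * r) p P0 X Y
  symE stars cardN _ _ p01 P0_gt0).
- by rewrite leq_pmull.
- by rewrite muln_gt0.
- move=> j jJ; apply: le_trans (prod_p_ge _); last by rewrite cardN.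
  rewrite ler_pdivrMr // mulrC ler_pdivlMr ?ltr0n ?expn_gt0 ?W_gt0 //.
  by rewrite -natrM ler_nat (leq_trans le_rWQ).
- move=> j b jJ bj.
  have d0 : 0 < (deg b)%:R :> rat.
    by rewrite ltr0n card_gt0; apply/set0Pn; exists j; rewrite inE jJ bj.
  apply: le_trans (_ : \sum_(j' in J | b \in N j') (r%:R / (deg b)%:R +
      \sum_(c in N j :\ b) (c \in N j')%:R * (P0 * (W ^ r)%:R)) <= _).
    rewrite big_mkcond [leRHS]big_mkcond /=; apply: ler_sum => j' _.
    case: (boolP (j' \in J)) => //= j'J.
    case: (boolP (b \in N j')) => /= bj'; last by rewrite andbF.
    rewrite andbT; have le := term_le jJ j'J bj bj'.
    case: ifP => // _; apply: le_trans le.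
    by rewrite divr_ge0 ?ltW.
  (* Over the [deg b] stars through [b] the main terms add up to exactly [r]; the correction is at
     most 1 for each other leaf [c], because [codeg b c * (r * W ^ r)] is at most
     [Q * codeg b c < D]. *)
  rewrite big_split /= sumr_const.
  have -> : #|[pred j' in J | b \in N j']| = deg b.
    by apply: eq_card => i; rewrite !inE.
  rewrite -[_ *+ deg b]mulr_natr divfK ?lt0r_neq0 // /X mulr_natl mulr2n lerD2l.
  rewrite exchange_big /=.
  apply: le_trans (_ : \sum_(c in N j :\ b) 1 <= _); last first.
    by rewrite sumr_const ler_nat -(cardN jJ); apply/subset_leq_card/subsetDl.
  apply: ler_sum => c; rewrite !inE => /andP [ne cj].
  rewrite -mulr_suml.
  have -> : \sum_(j' in J | b \in N j') (c \in N j')%:R = (codeg b c)%:R :> rat.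
    rewrite /codeg -sum1_card natr_sum [LHS]big_mkcond [RHS]big_mkcond /=.
    by apply: eq_bigr => i _; rewrite inE andbA; case: (_ && _); case: (c \in N i).
  rewrite [leLHS](_ : _ = (codeg b c * (r * W ^ r))%:R / D%:R); last first.
    by rewrite /P0 !natrM; ring.
  rewrite ler_pdivrMr // mul1r ler_nat eq_sym in ne *.
  apply: leq_trans (ltnW (codeg_lt jJ bj cj ne)).
  by rewrite mulnC leq_mul2r le_rWQ orbT.
- move=> j jJ; rewrite /P0 mulrA (ler_pdivrMr _ _ Dq) /Y.
  have := siblings_le jJ; rewrite -(ler_nat rat) !natrM.
  by lra.
(* Double counting: the expected numbers of kept leaves and of alive stars agree. *)
have -> : \sum_(b in B) p b = #|J|%:R * P0.
  rewrite (eq_bigr (fun b => (deg b)%:R * D%:R^-1)); last first.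
    by move=> b bB; rewrite /p bB.
  rewrite -mulr_suml -natr_sum sum_star_degrees // (eq_bigr (fun=> r) cardN).
  by rewrite sum_nat_const natrM mulrA.
have -> : 1 - Y - X / (8 * r)%:R = 1 / 2.
  by rewrite /Y /X natrM; field; rewrite lt0r_neq0.
have : 0 < r%:R * (#|J|%:R * P0) by rewrite mulr_gt0 // mulr_gt0 // ltr0n.
by rewrite natrM; lra.
Qed.

End SmallCodegree.

Lemma card_bigcup_le (I T : finType) (P : pred I) (F : I -> {set T}) :
  #|\bigcup_(i | P i) F i| <= \sum_(i | P i) #|F i|.
Proof.
elim/big_rec2: _ => [|i n A _ leA]; first by rewrite cards0.
by apply: leq_trans (leq_card_setU _ _) _; rewrite leq_add2l.
Qed.

(** * Levels with a wide range of degrees *)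

Section WideLevel.

Variables (T I : finType) (E : rel T) (J : {set I}) (pi : I -> T).
Variables (N : I -> {set T}) (B : {set T}) (t k D Q : nat).

Let codeg (b c : T) : nat := #|[set j in J | (b \in N j) && (c \in N j)]|.

(* Pairs of leaves sharing so many stars that a random sample would make
   their survival strongly correlated. *)
Let bad : rel T := fun b c => (b != c) && (D <= Q * codeg b c).

Hypothesis symE : symmetric E.
Hypothesis stars : star_family E J pi N B.
Hypothesis t_gt0 : 0 < t.
Hypothesis D_gt0 : 0 < D.
Hypothesis noK : ~ contains_Ktt E t.
Hypothesis cardN : forall j, j \in J -> #|N j| = k.
Hypothesis deg_le : forall b, b \in B -> #|[set j in J | b \in N j]| <= D.

Let codegC b c : codeg b c = codeg c b.
Proof. by apply: eq_card => j; rewrite !inE [(b \in _) && _]andbC. Qed.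

Let bad_sym : symmetric bad.
Proof. by move=> b c; rewrite /bad eq_sym codegC. Qed.

(** At most [D] stars pass through [b], so its codegrees sum to at most [k * D], and each bad
    partner uses at least [D / Q] of this. *)
Let card_bad_le b : b \in B -> #|[set c | bad b c]| <= k * Q.
Proof.
move=> bB; set M := [set c | _].
pose Jb := [set j in J | b \in N j].
suff : D * #|M| <= D * (k * Q) by rewrite leq_pmul2l.
have : \sum_(c in M) D <= Q * \sum_(c in M) codeg b c.
  by rewrite big_distrr; apply: leq_sum => c; rewrite inE => /andP [].
have -> : \sum_(c in M) codeg b c = \sum_(j in Jb) #|N j :&: M|.
  rewrite -(sum_star_degrees (B := M)) => [|j _]; last exact: subsetIr.
  apply: eq_bigr => c cM; apply: eq_card => j.
  by rewrite [in RHS]inE [in RHS]inE [in RHS]inE cM andbT !inE andbA.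
have : \sum_(j in Jb) #|N j :&: M| <= \sum_(j in Jb) k.
  apply: leq_sum => j; rewrite inE => /andP [jJ _].
  by rewrite -(cardN jJ); apply/subset_leq_card/subsetIl.
rewrite !sum_nat_const => le1 le2; rewrite mulnC; apply: leq_trans le2 _.
rewrite mulnC mulnA leq_mul2r (leq_trans le1) ?orbT // leq_mul2r.
by rewrite (deg_le bB) orbT.
Qed.

Let spoiled (b : T) : {set I} :=
  [set j in J | (b \in N j) && (t <= #|[set c in N j | bad b c]|)].

(** Such a star contains a [t]-set of bad partners of [b]. There are at most [(k * Q) ^ t] of these
    sets, each in fewer than [t] stars. *)
Let card_spoiled_le b : b \in B -> #|spoiled b| <= t * (k * Q) ^ t.
Proof.
move=> bB; set M := [set c | bad b c].
pose D' := [set S : {set T} | S \subset M & #|S| == t].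
have : spoiled b \subset \bigcup_(S in D') [set j in J | S \subset N j].
  apply/subsetP => j; rewrite inE => /and3P [jJ _ /subset_of_card [S Ssub cS]].
  apply/bigcupP; exists S.
    rewrite inE cS eqxx andbT; apply: subset_trans Ssub _.
    by apply/subsetP => c; rewrite !inE => /andP [].
  rewrite inE jJ; apply: subset_trans Ssub _.
  by apply/subsetP => c; rewrite inE => /andP [].
move=> /subset_leq_card /leq_trans; apply.
apply: leq_trans (_ : \sum_(S in D') t <= _).
  apply: leq_trans (card_bigcup_le _ _) _.
  apply: leq_sum => S; rewrite inE => /andP [_ /eqP cS].
  exact/ltnW/(common_stars_lt t_gt0 noK stars cS).
rewrite sum_nat_const cards_draws mulnC leq_pmul2l //.
apply: leq_trans (bin_le_exp _ _) _.
by rewrite leq_exp2r // card_bad_le.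
Qed.

(** Discard spoiled stars, at most half of all; shrink each remaining star to [r] leaves without bad
    pairs; prune leaves of degree below [h]. Degrees then lie between [h] and [D <= W * h], and
    codegrees stay below [D / Q]. *)
Lemma has_almost_regular_wide (r d W h : nat) :
  0 < r -> 0 < #|J| -> r * t <= k -> 12 * r <= k ->
  (forall j, j \in J -> k * #|[set j' in J | pi j' == pi j]| <= d) ->
  d <= 3 * D -> 2 * (#|B| * (t * (k * Q) ^ t)) <= #|J| ->
  2 * (#|B| * h) < #|J| -> D <= W * h -> r * W ^ r <= Q -> Q <= D ->
  has_almost_regular E (8 * r).
Proof.
move=> r0 J0 rtk r12k sib dD fewSpoiled prune DWh rWQ QD.
have [piB NB NE disj] := stars.
pose J1 := J :\: \bigcup_(b in B) spoiled b.
have J1J : J1 \subset J by exact: subsetDl.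
have cJ1 : #|J| <= 2 * #|J1|.
  have : #|\bigcup_(b in B) spoiled b| <= \sum_(b in B) t * (k * Q) ^ t.
    apply: leq_trans (card_bigcup_le _ _) _.
    by apply: leq_sum => b; exact: card_spoiled_le.
  rewrite sum_nat_const => le_sp; have := cardsD J (\bigcup_(b in B) spoiled b).
  have := subset_leq_card (subsetIr J (\bigcup_(b in B) spoiled b)).
  by rewrite -/J1; lia.
pose good j (V : {set T}) := [&& V \subset N j, #|V| == r &
  [forall x in V, forall y in V, (x != y) ==> ~~ bad x y]].
(* The default [set0] does not occur on [J1]: in an unspoiled star every leaf has fewer than [t] bad
   partners, and [r * t <= k] lets the greedy choice succeed. *)
pose N' j := odflt set0 [pick V | good j V].
have N'P j : j \in J1 -> good j (N' j).
  rewrite inE => /andP [nsp jJ]; rewrite /N'.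
  case: pickP => //= none; exfalso.
  have [|b bN|V [VN cV ind]] := @independent_subset T bad t r (N j) bad_sym t_gt0.
  - by rewrite cardN.
  - rewrite ltnNge; apply: contra nsp => le_t; apply/bigcupP; exists b.
      exact: (subsetP (NB j jJ)).
    by rewrite inE jJ bN.
  have := none V; rewrite /good VN cV eqxx /= => /negbT /negP; apply.
  apply/forallP => x; apply/implyP => xV; apply/forallP => y; apply/implyP => yV.
  by apply/implyP; exact: ind.
have N'N j : j \in J1 -> N' j \subset N j by move=> /N'P /and3P [].
have [||J2 [B2 [J2J1 B2B J2_gt0 NB2 deg2]]] :=
    @prune_stars T I J1 N' B h.
- by move=> j jJ1; apply: subset_trans (N'N j jJ1) (NB j (subsetP J1J j jJ1)).
- by lia.
have J2J := subset_trans J2J1 J1J.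
have inJ1 j : j \in J2 -> j \in J1 by exact: (subsetP J2J1).
have inJ j : j \in J2 -> j \in J by exact: (subsetP J2J).
have N'sub j b : j \in J2 -> b \in N' j -> b \in N j.
  by move=> /inJ1 /N'N /subsetP; exact.
apply: (@has_almost_regular_small_codegree T I E J2 pi N' B2 r D Q W h) => //.
- split.
  + by move=> j /inJ /piB; apply: contra; exact: (subsetP B2B).
  + exact: NB2.
  + by move=> j b jJ2 /N'sub -/(_ jJ2); exact/NE/inJ.
  + move=> j j' jJ2 j'J2 ne epi.
    apply: disjointWl (N'N j (inJ1 j jJ2)) _.
    apply: disjointWr (N'N j' (inJ1 j' j'J2)) _.
    by apply: disj => //; exact: inJ.
- by move=> j /inJ1 /N'P /and3P [_ /eqP].
- move=> b bB2; rewrite deg2 //=; apply: leq_trans (deg_le (subsetP B2B b bB2)).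
  apply/subset_leq_card/subsetP => j; rewrite !inE => /andP [jJ2 bN'].
  by rewrite inJ // (N'sub j).
- move=> j b c jJ2 bN' cN' ne.
  have /and3P [_ _ /forallP /(_ b)] := N'P j (inJ1 j jJ2).
  rewrite bN' => /forallP /(_ c); rewrite cN' ne /= /bad ne /= -ltnNge.
  apply: leq_ltn_trans; rewrite leq_mul2l; apply/orP; right.
  apply/subset_leq_card/subsetP => i; rewrite !inE => /and3P [iJ2 bi ci].
  by rewrite inJ // !(N'sub i).
(* From [12 * r <= k] and [d <= 3 * D]. *)
- move=> j jJ2; have := sib j (inJ j jJ2).
  have : #|[set j' in J2 | pi j' == pi j]| <= #|[set j' in J | pi j' == pi j]|.
    by apply/subset_leq_card/subsetP => i; rewrite !inE => /andP [/inJ -> ->].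
  by nia.
Qed.

End WideLevel.

Lemma sum_sdegE (T : finType) (F : rel T) :
  \sum_(v in [set: T]) sdeg [set: T] F v = \sum_x \sum_y (F x y : nat).
Proof.
rewrite big_mkcond; apply: eq_bigr => x _; rewrite inE /sdeg -sum1_card big_mkcond.
by apply: eq_bigr => y _; rewrite !inE; case: (F x y).
Qed.

(** * A bipartite subgraph with half of the edges *)

Section Bipartition.

Import mathcomp.algebra_tactics.ring mathcomp.algebra_tactics.lra.

Local Open Scope ring_scope.

(** In a uniformly random cut, an ordered edge goes from [X] to its complement with probability
    [1 / 4]; the two orientations together give one half. *)
Lemma exists_half_cut (T : finType) (E : rel T) : symmetric E -> irreflexive E ->
  exists X : {set T}, (\sum_(v in [set: T]) sdeg [set: T] E v <=
    2 * \sum_(v in [set: T])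
          sdeg [set: T] (fun x y => E x y && ((x \in X) != (y \in X))) v)%N.
Proof.
move=> symE irrE; pose rho (x : T) : rat := 1 / 2.
pose c := (\sum_x \sum_y (E x y : nat))%N.
pose f (X : {set T}) : rat := \sum_x \sum_(y | E x y)
  (([set x] \subset X)%:R - ([set x; y] \subset X)%:R).
(* The constant 1 is written as [set0 \subset X] so that its mean is again a superset probability.
   The mean here is 1, and integrality turns [4 * g > c - 1] into [c <= 4 * g]. *)
have [X] : exists X, 0 < 4%:R * f X - (c%:R - 1) * (set0 \subset X)%:R.
  apply: (exists_of_mean_gt0 (rho := rho)); first by move=> x; rewrite /rho; lra.
  rewrite -/(mean _ _) meanB !meanZ mean_sum mean_superset big_set0.
  suff -> : \sum_x mean rho (fun X => \sum_(y | E x y)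
      (([set x] \subset X)%:R - ([set x; y] \subset X)%:R)) = c%:R / 4 by lra.
  rewrite /c natr_sum mulr_suml; apply: eq_bigr => x _.
  rewrite mean_sum natr_sum mulr_suml big_mkcond /=; apply: eq_bigr => y _.
  case: ifP => Exy; last by rewrite mul0r.
  have ne : x != y by apply: contraTneq Exy => ->; rewrite irrE.
  by rewrite meanB !mean_superset big_set1 big_setU1 ?inE //= big_set1 /rho; lra.
rewrite sub0set mulr1.
pose g := (\sum_x \sum_y (E x y && ((x \in X) && (y \notin X)) : nat))%N.
have -> : f X = g%:R.
  rewrite /f /g natr_sum; apply: eq_bigr => x _; rewrite natr_sum big_mkcond /=.
  apply: eq_bigr => y _; rewrite sub1set subUset !sub1set.
  by case: (E x y); case: (x \in X); case: (y \in X) => //=; rewrite ?subrr ?subr0.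
move=> pos; have le_cg : (c <= 4 * g)%N.
  rewrite -ltnS -(ltr_nat rat) -natr1 natrM; lra.
exists X; rewrite !sum_sdegE -/c.
suff -> : (\sum_x \sum_y (E x y && ((x \in X) != (y \in X)) : nat) = 2 * g)%N by lia.
have gC : g = (\sum_x \sum_y (E x y && ((x \notin X) && (y \in X)) : nat))%N.
  rewrite /g exchange_big; apply: eq_bigr => x _; apply: eq_bigr => y _ /=.
  by rewrite symE [(y \in X) && _]andbC.
rewrite mul2n -addnn {2}gC /g -big_split; apply: eq_bigr => x _.
rewrite -big_split; apply: eq_bigr => y _ /=.
by case: (E x y); case: (x \in X); case: (y \in X).
Qed.

End Bipartition.

(** * Cutting a set into blocks of size [k] *)

Section Chunks.

Variables (T : finType) (k : nat).
Hypothesis k_gt0 : 0 < k.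

Definition chunk (S : {set T}) (i : nat) : {set T} :=
  [set x in take k (drop (i * k) (enum S))].

Lemma chunk_sub (S : {set T}) i : chunk S i \subset S.
Proof.
by apply/subsetP => x; rewrite inE => /mem_take /mem_drop; rewrite mem_enum.
Qed.

Lemma card_chunk (S : {set T}) i : i.+1 * k <= #|S| -> #|chunk S i| = k.
Proof.
move=> le_i; rewrite cardsE (card_uniqP _); last first.
  by rewrite take_uniq // drop_uniq // enum_uniq.
by rewrite size_takel // size_drop -cardE; lia.
Qed.

(** The position of an element determines its block, so distinct blocks are disjoint. *)
Lemma chunk_index (S : {set T}) i x : x \in chunk S i -> index x (enum S) %/ k = i.
Proof.
rewrite inE => xs; set s := take _ _ in xs.
have lt_s : index x s < size s by rewrite index_mem.
have := nth_index x xs.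
have lt_k : index x s < k.
  by apply: leq_trans lt_s _; rewrite size_take_min geq_minl.
rewrite {1}/s nth_take // nth_drop => nthx.
have lt_e : i * k + index x s < size (enum S).
  move: lt_s; rewrite {2}/s size_take_min size_drop; lia.
rewrite -{1}nthx index_uniq ?enum_uniq // divnMDl // divn_small ?addn0 //.
Qed.

Lemma card_chunk_indices (n s : nat) : s <= n ->
  #|[set i : 'I_n | i.+1 * k <= s]| = s %/ k.
Proof.
move=> le_sn; have le_q : s %/ k <= n by apply: leq_trans (leq_div _ _) le_sn.
rewrite -sum1_card (eq_bigl (fun i : 'I_n => i < s %/ k)); last first.
  by move=> i; rewrite inE leq_divRL.
by rewrite (big_ord_narrow le_q) sum1_card card_ord.
Qed.

End Chunks.

(** * A level carrying many stars *)

Section Level.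

Variables (T L : finType) (E : rel T) (A B : {set T}) (G : T -> {set T}).
Variables (lev : T -> L) (d k : nat).

Let g (b : T) : nat := #|[set a in A | b \in G a]|.
Let Bl (l : L) : {set T} := [set b in B | (d <= 3 * g b) && (lev b == l)].

Hypothesis disjAB : [disjoint A & B].
Hypothesis GB : forall a, a \in A -> G a \subset B.
Hypothesis GE : forall a b, a \in A -> b \in G a -> E a b.
Hypothesis cardG : forall a, a \in A -> #|G a| = d.
Hypothesis leBA : #|B| <= #|A|.
Hypothesis A_gt0 : 0 < #|A|.
Hypothesis k_gt0 : 0 < k.
Hypothesis few_levels : 4 * k * #|L| <= d.

Let e (l : L) : nat := \sum_(b in Bl l) g b.

(** Of the [#|A| * d] edges, leaves of degree below [d / 3] carry at most a third, since
    [#|B| <= #|A|]. The levels share the rest, and [d] is at least [4 * k] times their number. *)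
Let heavy_level : exists l, 8 * k * #|A| <= 3 * e l.
Proof.
apply/existsP; apply: contraT => /existsPn light.
have sum_e : \sum_l e l = \sum_(b in B | d <= 3 * g b) g b.
  rewrite (partition_big lev xpredT) //=; apply: eq_bigr => l _.
  by apply: eq_bigl => b; rewrite inE andbA.
have sum_g : \sum_(b in B) g b = #|A| * d.
  rewrite sum_star_degrees // (eq_bigr (fun=> d)) ?sum_nat_const //.
have low : 3 * \sum_(b in B | ~~ (d <= 3 * g b)) g b <= #|B| * d.
  rewrite big_distrr /= -sum_nat_const [leqRHS](bigID (fun b => d <= 3 * g b)) /=.
  apply: leq_trans (leq_addl _ _); apply: leq_sum => b /andP [_].
  by rewrite -ltnNge => /ltnW.
have : 3 * \sum_l e l + #|L| <= #|L| * (8 * k * #|A|).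
  rewrite big_distrr /= -sum_nat_const -[X in _ + X]sum1_card -big_split /=.
  by apply: leq_sum => l _; rewrite addn1 ltnNge light.
move: sum_g; rewrite (bigID (fun b => d <= 3 * g b)) /= -sum_e => sum_g.
have : #|B| * d <= #|A| * d by rewrite leq_mul2r leBA orbT.
have [a _] : exists a, a \in A by apply/set0Pn; rewrite -card_gt0.
have : 0 < #|L| by apply/card_gt0P; exists (lev a).
have : 4 * k * #|L| * #|A| <= d * #|A| by rewrite leq_mul2r few_levels orbT.
have -> : #|L| * (8 * k * #|A|) = 2 * (4 * k * #|L| * #|A|) by lia.
rewrite [d * _]mulnC; move: sum_g low; move: (4 * k * #|L| * #|A|) => u.
move: (\sum_l e l) (\sum_(b in B | ~~ (d <= 3 * g b)) g b) (#|A| * d) (#|B| * d) #|L|.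
by lia.
Qed.

(** A star is a pair of centre and block number. Incomplete blocks waste at most [k * #|A|] edges,
    which is at most [3 / 8] of [e l] in a heavy level; this gives the factor [5 / 8]. *)
Lemma exists_level_stars : exists l (J : {set T * 'I_#|T|}) (N : T * 'I_#|T| -> {set T}),
  [/\ star_family E J fst N (Bl l), 0 < #|J|,
      forall j, j \in J -> #|N j| = k /\ k * #|[set j' in J | j'.1 == j.1]| <= d,
      forall b, b \in Bl l -> #|[set j in J | b \in N j]| <= g b &
      5 * e l <= 8 * k * #|J|].
Proof.
have [l heavy] := heavy_level.
pose S a := G a :&: Bl l.
pose N (j : T * 'I_#|T|) := chunk k (S j.1) j.2.
pose J := [set j : T * 'I_#|T| | (j.1 \in A) && (j.2.+1 * k <= #|S j.1|)].
have same_chunk j j' b : j.1 = j'.1 -> b \in N j -> b \in N j' -> j = j'.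
  case: j j' => [a i] [a' i'] /= <- /(chunk_index k_gt0) hi /(chunk_index k_gt0).
  by rewrite hi => hi'; congr (_, _); exact: val_inj.
have NS j : N j \subset S j.1 by exact: chunk_sub.
have sum_S : \sum_(a in A) #|S a| = e l.
  rewrite -(@sum_star_degrees _ _ A S (Bl l)) => [|a _]; last exact: subsetIr.
  apply: eq_bigr => b bB; apply: eq_card => a; rewrite !inE.
  by move: bB; rewrite inE => ->; rewrite andbT.
have cardJ : #|J| = \sum_(a in A) #|S a| %/ k.
  rewrite (eq_bigr (fun a => \sum_(i < #|T| | i.+1 * k <= #|S a|) 1)); last first.
    move=> a aA; rewrite -(card_chunk_indices k_gt0 (max_card (mem (S a)))).
    by rewrite -sum1_card; apply: eq_bigl => i; rewrite inE.
  by rewrite pair_big_dep -sum1_card; apply: eq_bigl => j; rewrite inE.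
have le_e : e l <= k * #|J| + k * #|A|.
  rewrite -sum_S cardJ -[#|A|]sum1_card !big_distrr -big_split /=.
  apply: leq_sum => a _; have := divn_eq #|S a| k; have := ltn_pmod #|S a| k_gt0.
  by nia.
exists l, J, N; split.
- split.
  + move=> [a i]; rewrite inE /= => /andP [aA _]; rewrite inE.
    by rewrite (disjointFr disjAB aA).
  + by move=> j _; apply: subset_trans (NS j) (subsetIr _ _).
  + move=> j b; rewrite inE => /andP [aA _] /(subsetP (NS j)).
    by rewrite inE => /andP [bG _]; exact: GE.
  + move=> j j' _ _ ne epi; rewrite -setI_eq0; apply/eqP/setP => b.
    rewrite in_setI in_set0; apply/negbTE/negP => /andP [bj bj'].
    by rewrite (same_chunk j j' b epi bj bj') eqxx in ne.
- rewrite lt0n; apply/negP => /eqP J0; have : 0 < k * #|A| by rewrite muln_gt0 k_gt0.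
  by move: le_e heavy; rewrite J0 muln0 -!mulnA; move: (k * #|A|) (e l); lia.
- move=> j; rewrite inE => /andP [aA le_j]; split; first exact: card_chunk.
  rewrite -(@card_in_imset _ _ snd); last first.
    move=> [a i] [a' i']; rewrite !inE /= => /andP [_ /eqP ->] /andP [_ /eqP ->].
    by move=> ->.
  apply: leq_trans (_ : k * #|[set i : 'I_#|T| | i.+1 * k <= #|S j.1|]| <= _).
    rewrite leq_mul2l; apply/orP; right; apply/subset_leq_card/subsetP => i.
    move=> /imsetP [[a i']]; rewrite !inE /= => /andP [/andP [_ le_i] /eqP ea] ->.
    by rewrite -ea.
  rewrite card_chunk_indices ?max_card // mulnC.
  apply: leq_trans (leq_divM _ _) _; rewrite -(cardG aA).
  exact/subset_leq_card/subsetIl.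
- move=> b _; rewrite -(@card_in_imset _ _ fst); last first.
    move=> j j' /setIdP [_ bj] /setIdP [_ bj'] epi.
    exact: same_chunk epi bj bj'.
  apply/subset_leq_card/subsetP => a /imsetP [j /setIdP [jJ bj] ->].
  move: jJ; rewrite !inE => /andP [-> _] /=.
  by have := subsetP (NS j) b bj; rewrite inE => /andP [].
- move: le_e heavy; rewrite -!mulnA.
  by move: (k * #|A|) (k * #|J|) (e l); lia.
Qed.

End Level.

(* The exponents [x] with [trunc_log 2 x = i] are cut into at most [2 ^ c]
   windows of width [w]; window [y] ends at [m]. For [i <= c] the truncated
   [i - c] gives [w = 1], i.e. a dyadic range of degrees. *)
Lemma level_bounds (c g : nat) : 1 < g ->
  let x := up_log 2 g in let i := trunc_log 2 x in
  let w := 2 ^ (i - c) in let y := (x - 2 ^ i) %/ w in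
  let m := 2 ^ i + y.+1 * w - 1 in
  [/\ y < 2 ^ c, g <= 2 ^ m & 2 ^ (m - w) <= g].
Proof.
move=> g1 x i w y m.
have /andP [gx1 gx] := up_log_bounds (isT : 1 < 2) g1; rewrite -/x in gx1 gx.
have x0 : 0 < x by rewrite up_log_gt0.
have /andP [ix xi] := trunc_log_bounds (isT : 1 < 2) x0; rewrite -/i expnS in ix xi.
have w0 : 0 < w by rewrite expn_gt0.
have yE := divn_eq (x - 2 ^ i) w; have yr := ltn_pmod (x - 2 ^ i) w0.
rewrite -/y in yE.
have le_iw : 2 ^ i <= 2 ^ c * w by rewrite -expnD leq_exp2l //; lia.
have mx : x <= m by rewrite /m; nia.
have mwx : m - w <= x.-1 by rewrite /m; nia.
split.
- by nia.
- by apply: leq_trans gx _; rewrite leq_exp2l.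
- by apply: leq_trans (ltnW gx1); rewrite leq_exp2l.
Qed.

(** All quantities become powers of two: [D = 2 ^ m], [Q = 2 ^ e], [W = 2 ^ w'] and
    [h = 2 ^ (m - w')]. The lower bound on [2 ^ c] makes [w] so small against [m] that
    [kappa + w' * r <= e]; the bounds then follow by comparing exponents. *)
Lemma wide_parameters (t r kappa c m w : nat) :
  0 < t -> 0 < r -> 12 * r * t <= 2 ^ kappa ->
  8 * t * r * (2 * kappa + 3) <= 2 ^ c -> 2 ^ c <= m -> w * 2 ^ c <= m ->
  let k := 12 * r * t in let e := m %/ (4 * t) in let w' := w + kappa + 3 in
  [/\ 4 * t * k * (k * 2 ^ e) ^ t <= 2 ^ (m - w), r * (2 ^ w') ^ r <= 2 ^ e,
      e <= m, w' <= m & 8 * k * 2 ^ (m - w') <= 2 ^ (m - w)].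
Proof.
move=> t0 r0 lek lec lem lew k e w'.
have te : e * (4 * t) <= m by exact: leq_divM.
have kap0 : 0 < kappa by move: lek; case: (kappa) => //; nia.
have tr0 : 0 < t * r by rewrite muln_gt0 t0.
have trk : 16 * (t * r * kappa) + 24 * (t * r) <= m.
  by apply: leq_trans lem; apply: leq_trans lec; nia.
have wtr : 24 * (w * (t * r)) <= m.
  apply: leq_trans lew; apply: leq_trans (_ : w * (8 * t * r * (2 * kappa + 3)) <= _).
    by nia.
  by rewrite leq_mul2l lec orbT.
have ltr : t <= t * r by rewrite leq_pmulr.
have ltk : t * kappa <= t * r * kappa by rewrite leq_mul2r ltr orbT.
have lkk : kappa <= t * kappa by rewrite leq_pmull.
have lww : w <= w * (t * r) by rewrite leq_pmulr.
have le_e : kappa + w' * r <= e.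
  by rewrite leq_divRL ?muln_gt0 // /w'; nia.
have le_em : e <= m by apply: leq_div.
have w'm : w' <= m.
  by apply: leq_trans le_em; apply: leq_trans le_e; nia.
have tk : t <= 2 ^ kappa by apply: leq_trans lek; nia.
split=> //.
- apply: leq_trans (_ : 2 ^ (2 + kappa + kappa + (kappa + e) * t) <= _); last first.
    by rewrite leq_exp2l //; nia.
  rewrite expnD expnM !expnD; apply: leq_mul; first by rewrite !leq_mul.
  by rewrite leq_exp2r // leq_mul2r lek orbT.
- apply: leq_trans (_ : 2 ^ (kappa + w' * r) <= _); last by rewrite leq_exp2l.
  rewrite expnD expnM leq_mul2r; apply/orP; right.
  by apply: leq_trans lek; nia.
- apply: leq_trans (_ : 2 ^ (3 + kappa + (m - w')) <= _).
    by rewrite !expnD leq_mul2r; apply/orP; right; rewrite leq_mul2l lek orbT.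
  by rewrite leq_exp2l // /w'; lia.
Qed.

(** About [loglog n] rows of exponents, with [2 ^ c] windows each. *)
Definition level_count (n c : nat) : nat :=
  (trunc_log 2 (up_log 2 n)).+1 * 2 ^ c.

(** The average degree exceeds [4 * d] for the [d] set below: the cut costs a factor 2 and passing
    to minimum degree another, leaving at least [d] neighbours for every centre. *)
Lemma has_almost_regular_of_sum_sdeg (T : finType) (E : rel T)
    (t r kappa c : nat) :
  simple_graph E -> 0 < t -> 0 < r -> ~ contains_Ktt E t ->
  12 * r * t <= 2 ^ kappa -> 8 * t * r * (2 * kappa + 3) <= 2 ^ c ->
  4 * (4 * (12 * r * t) * level_count #|T| c) * #|T| <
    \sum_(v in [set: T]) sdeg [set: T] E v ->
  has_almost_regular E (8 * r).
Proof.
move=> [symE irrE] t0 r0 noK lek lec dens.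
set k := 12 * r * t in lek dens *.
set d := 4 * k * level_count #|T| c in dens.
have k0 : 0 < k by rewrite !muln_gt0 r0 t0.
(* Ensures that [d <= 3 * g b] forces [1 < g b], as needed for the level bounds. *)
have d6 : 6 <= d by rewrite /d /level_count; have := expn_gt0 2 c; nia.
have [X cutX] := exists_half_cut symE irrE.
set F : rel T := fun x y => E x y && ((x \in X) != (y \in X)) in cutX.
have symF : symmetric F by move=> x y; rewrite /F symE eq_sym.
have [|S [_ S0 degS]] := @min_degree_subset T F symF d 1 [set: T].
  by rewrite cardsT; lia.
have [X' [leX FX']] : exists X' : {set T}, #|S :\: X'| <= #|S :&: X'| /\
    forall x y, F x y -> x \in X' -> y \notin X'.
  have [le|/ltnW le] := leqP #|S :\: X| #|S :&: X|.
    exists X; split=> // x y /andP [_]; case: (x \in X) => //.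
  exists (~: X); rewrite -setDE setDE setCK; split=> // x y /andP [_].
  by rewrite !inE; case: (x \in X).
pose A := S :&: X'; pose B := S :\: X'.
pose G a := chunk d [set u in S | F a u] 0.
have GS a : G a \subset [set u in S | F a u] by exact: chunk_sub.
have cardG a : a \in A -> #|G a| = d.
  rewrite inE => /andP [aS _]; apply: card_chunk; first by lia.
  by rewrite mul1n; have := degS a aS; rewrite mul1n => /ltnW.
have GB a : a \in A -> G a \subset B.
  rewrite inE => /andP [aS aX]; apply/subsetP => b /(subsetP (GS a)).
  by rewrite !inE => /andP [-> Fab]; rewrite (FX' a b).
pose g b := #|[set a in A | b \in G a]|.
have gT b : g b <= #|T| by exact: max_card.
pose row b := trunc_log 2 (up_log 2 (g b)).
pose col b := (up_log 2 (g b) - 2 ^ row b) %/ 2 ^ (row b - c).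
pose I0 := trunc_log 2 (up_log 2 #|T|).
(* The form [(2 ^ c).-1.+1] is a visible successor, as [inord] demands. The column is in range only
   when [1 < g b], which holds on [Bl]. *)
pose lev b : 'I_I0.+1 * 'I_(2 ^ c).-1.+1 := (inord (row b), inord (col b)).
have rowI b : row b < I0.+1 by rewrite ltnS; exact/leq_trunc_log/leq_up_log.
have [|||||||| l [J [N [stars J0 cardN degJ dense]]]] :=
    @exists_level_stars T _ E A B G lev d k.
- rewrite -setI_eq0; apply/eqP/setP => b; rewrite !inE.
  by case: (b \in X'); rewrite ?andbF.
- exact: GB.
- by move=> a b aA /(subsetP (GS a)); rewrite inE => /andP [_ /andP []].
- exact: cardG.
- exact: leX.
- have : 0 < #|S| by rewrite card_gt0.
  rewrite -(cardsID X' S) -/A -/B; move: leX; rewrite -/A -/B.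
  by move: #|A| #|B|; lia.
- exact: k0.
- by rewrite card_prod !card_ord prednK ?expn_gt0 // /d /level_count.
pose w := 2 ^ (l.1 - c); pose m := 2 ^ l.1 + l.2.+1 * w - 1.
set Bl := [set b in B | _] in stars degJ dense.
have BlP b : b \in Bl -> [/\ d <= 3 * g b, g b <= 2 ^ m & 2 ^ (m - w) <= g b].
  rewrite inE => /and3P [_ le_d /eqP lev_b]; have g1 : 1 < g b.
    by move: le_d; rewrite -/(g b); move: d6; move: (g b); lia.
  have [lt_y le_m ge_m] := level_bounds c g1.
  have row_b : row b = l.1 by rewrite -lev_b /= inordK.
  have col_b : col b = l.2.
    by rewrite -lev_b /= inordK // prednK ?expn_gt0.
  rewrite -/(row b) -/(col b) row_b col_b in le_m ge_m.
  by split.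
have [j0 j0J] : exists j, j \in J by apply/set0Pn; rewrite -card_gt0.
have [_ NB _ _] := stars.
have [b0 b0B] : exists b, b \in Bl.
  have [cN _] := cardN j0 j0J.
  have /set0Pn [b bN] : N j0 != set0 by rewrite -card_gt0 cN.
  by exists b; exact: (subsetP (NB j0 j0J)).
have dD : d <= 3 * 2 ^ m by have [] := BlP b0 b0B; lia.
have degD b : b \in Bl -> #|[set j in J | b \in N j]| <= 2 ^ m.
  by move=> bB; apply: leq_trans (degJ b bB) _; have [] := BlP b bB.
have cB : 5 * (#|Bl| * 2 ^ (m - w)) <= 8 * k * #|J|.
  apply: leq_trans dense; rewrite leq_mul2l -sum_nat_const; apply/orP; right.
  by apply: leq_sum => b bB; have [] := BlP b bB.
have cN j : j \in J -> #|N j| = k by move=> /cardN [].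
have sib j : j \in J -> k * #|[set j' in J | j'.1 == j.1]| <= d.
  by move=> /cardN [].
have w0 : 0 < w by rewrite expn_gt0.
(* Low rows have windows of width [w = 1], so degrees agree up to a factor 2. In higher rows
   [w * 2 ^ c = 2 ^ l.1 <= m], which is the wide case. *)
have [le_ic|lt_ci] := leqP l.1 c.
  apply: (@has_almost_regular_weaken _ _ k); first by rewrite /k; nia.
  apply: (has_almost_regular_narrow (D := 2 ^ m) (d := d) symE stars) => //.
  have w1 : w = 1 by rewrite /w (eqP le_ic).
  have m0 : 0 < m by rewrite /m w1; have := expn_gt0 2 l.1; lia.
  have -> : 2 ^ m = 2 * 2 ^ (m - w) by rewrite w1 -expnS -subSn // subn1.
  by move: cB; nia.
have le_im : 2 ^ l.1 <= m.
  have : 0 < l.2.+1 * w by rewrite muln_gt0 w0.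
  by rewrite /m; move: (l.2.+1 * w); lia.
have le_cm : 2 ^ c <= m.
  by apply: leq_trans le_im; rewrite leq_exp2l // ltnW.
have le_wm : w * 2 ^ c <= m.
  by rewrite /w -expnD subnK ?(ltnW lt_ci).
have [P1 P2 P3 P4 P5] := wide_parameters t0 r0 lek lec le_cm le_wm.
rewrite -/k in P1 P5.
apply: (has_almost_regular_wide symE stars t0 _ noK cN degD
  (Q := 2 ^ (m %/ (4 * t))) (r := r) (d := d)
  (W := 2 ^ (w + kappa + 3)) (h := 2 ^ (m - (w + kappa + 3)))) => //.
- by rewrite expn_gt0.
- by rewrite /k -mulnA leq_pmull.
- by rewrite /k leq_pmulr.
- have k8_gt0 : 0 < 8 * k by rewrite muln_gt0.
  rewrite -(leq_pmul2l k8_gt0).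
  apply: leq_trans cB; apply: leq_trans (leq_mul (leqnn 5) (leq_mul (leqnn #|Bl|) P1)).
  move: ((k * _) ^ t) => u; rewrite (_ : 8 * k * _ = 16 * (#|Bl| * t * k * u)); last by lia.
  by rewrite (_ : 5 * _ = 20 * (#|Bl| * t * k * u)); [rewrite leq_mul2r orbT | lia].
- have : 8 * k * (5 * (#|Bl| * 2 ^ (m - (w + kappa + 3)))) <= 8 * k * #|J|.
    apply: leq_trans cB; apply: leq_trans (leq_mul (leqnn 5) (leq_mul (leqnn #|Bl|) P5)).
    by rewrite mulnCA leq_mul2l mulnCA leqnn orbT.
  rewrite leq_pmul2l; last by rewrite muln_gt0.
  move: J0.
  by move: (#|Bl| * _) #|J|; clear; lia.
- by rewrite -expnD subnKC.
- by rewrite leq_exp2l.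
Qed.

(** * Degree sums, edge counts and complete bipartite subgraphs *)

(** Each edge, a two-element set, comes from exactly two ordered pairs. *)
Lemma sum_rel_nedges (T : finType) (F : rel T) : symmetric F -> irreflexive F ->
  \sum_x \sum_y (F x y : nat) = 2 * nedges F.
Proof.
move=> symF irrF; rewrite pair_big /=.
transitivity (\sum_(p : T * T | F p.1 p.2) 1).
  by rewrite [RHS]big_mkcond; apply: eq_bigr => -[x y] _ /=; case: (F x y).
pose edge (p : T * T) : {set T} := [set p.1; p.2].
rewrite /nedges; set edges := [set A | _].
rewrite (partition_big edge [in edges]) /=; last first.
  move=> [x y] /= Fxy; rewrite inE; apply/existsP; exists x.
  by apply/existsP; exists y; rewrite Fxy eqxx.
rewrite mulnC -sum_nat_const; apply: eq_bigr => A.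
rewrite inE => /existsP [x /existsP [y /andP [Fxy /eqP ->]]].
have ne : x != y by apply: contraTneq Fxy => ->; rewrite irrF.
have -> : 2 = #|[set (x, y); (y, x)]|.
  by rewrite cards2 xpair_eqE negb_and ne.
rewrite -sum1_card; apply: eq_bigl => -[u v]; rewrite !inE !xpair_eqE /=.
apply/andP/orP.
  case=> Fuv /eqP /setP eqs.
  have neuv : u != v by apply: contraTneq Fuv => ->; rewrite irrF.
  have := eqs u; have := eqs v; rewrite /edge !inE !eqxx /= orbT.
  move=> /esym /orP [] /eqP ev /esym /orP [] /eqP eu; rewrite eu ev ?eqxx in neuv *.
  - by right.
  - by right.
  - by left.
  - by [].
case=> /andP [/eqP -> /eqP ->]; rewrite /edge /= ?eqxx //.
by rewrite symF Fxy setUC eqxx.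
Qed.

Lemma sum_sdeg_nedges (T : finType) (E F : rel T) (S : {set T}) :
  irreflexive E -> is_subgraph E S F ->
  \sum_(v in S) sdeg S F v = 2 * nedges F.
Proof.
move=> irrE [symF [FE FS]]; rewrite -sum_rel_nedges //; last first.
  by move=> x; apply/negP => /FE; rewrite irrE.
rewrite big_mkcond; apply: eq_bigr => x _; case: ifP => xS.
  rewrite /sdeg -sum1_card big_mkcond; apply: eq_bigr => y _; rewrite inE.
  by case Fxy: (F x y); rewrite ?andbF //; have /andP [_ ->] := FS x y Fxy.
rewrite big1 // => y _; case Fxy: (F x y) => //.
by have := FS x y Fxy; rewrite xS.
Qed.

Lemma has_almost_regular_Ktt (T : finType) (E : rel T) (t : nat) :
  symmetric E -> 0 < t -> contains_Ktt E t -> has_almost_regular E (64 * t).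
Proof.
move=> symE t0 [A [B [cA [cB [disj AB]]]]].
pose F : rel T := fun x y => (x \in A) && (y \in B) || (x \in B) && (y \in A).
have deg v : v \in A :|: B -> sdeg (A :|: B) F v = t.
  rewrite inE => /orP [vA|vB].
    rewrite -cB; apply: eq_card => u; rewrite !inE /F vA (disjointFr disj vA) /=.
    by rewrite orbF; case: (u \in B); rewrite ?orbT ?andbF.
  rewrite -cA; apply: eq_card => u; rewrite !inE /F vB (disjointFl disj vB) /=.
  by case: (u \in A); rewrite ?andbF.
exists (A :|: B), F; split.
- by rewrite -card_gt0; apply: leq_trans (subset_leq_card (subsetUl A B)); rewrite cA.
- split; first by move=> x y; rewrite /F orbC [(y \in A) && _]andbC [(y \in B) && _]andbC.
  split=> x y /orP [] /andP [xA yB]; rewrite ?inE ?xA ?yB ?orbT //; first exact: AB.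
  by rewrite symE; exact: AB.
- by move=> u v uS vS; rewrite !deg //; lia.
- by move=> v vS; rewrite deg.
Qed.

From Stdlib Require Import ZArith Reals Lra.

(** * Real logarithms and the quantitative bound *)

Section Asymptotics.

Local Open Scope R_scope.

Lemma has_almost_regular_avg_deg (T : finType) (E : rel T) (q : nat) :
  irreflexive E -> has_almost_regular E q ->
  exists (S : {set T}) (F : rel T), S != set0 /\ is_subgraph E S F /\
    almost_regular 64 S F /\ INR q / 64 <= avg_deg S F.
Proof.
move=> irrE [S [F [S0 sub areg deg]]]; exists S, F; do 3 split=> //.
have cS : (0 < #|S|)%nat by rewrite card_gt0.
have : (#|S| * q <= 64 * (2 * nedges F))%nat.
  rewrite -(sum_sdeg_nedges irrE sub) -sum_nat_const big_distrr.
  by apply: leq_sum.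
move=> /ssrnat.leP /le_INR; rewrite !mult_INR.
have -> : INR 64 = 64 by rewrite INR_IZR_INZ.
have -> : INR 2 = 2 by rewrite INR_IZR_INZ.
have : 0 < INR #|S| by apply: lt_0_INR; apply/ssrnat.ltP.
rewrite /avg_deg; move: (INR #|S|) (INR q) (INR (nedges F)) => s x e s0 le.
apply: (Rmult_le_reg_r (64 * s)); first lra.
have -> : x / 64 * (64 * s) = s * x by field.
have -> : 2 * e / s * (64 * s) = 64 * (2 * e) by field; lra.
exact: le.
Qed.

Lemma INR_expn2 (a : nat) : INR (expn 2 a) = 2 ^ a.
Proof. by elim: a => // a IHa; rewrite expnS mult_INR IHa. Qed.

Lemma ln2_gt0 : 0 < ln 2.
Proof. by rewrite -ln_1; apply: ln_increasing; lra. Qed.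

Lemma log2_le (x y : R) : 0 < x -> x <= y -> log2 x <= log2 y.
Proof.
move=> x0 xy; apply: Rmult_le_compat_r.
  by apply: Rlt_le; apply: Rinv_0_lt_compat; exact: ln2_gt0.
case: xy => [lt|->]; last exact: Rle_refl.
by apply: Rlt_le; exact: ln_increasing.
Qed.

Lemma log2_mul (x y : R) : 0 < x -> 0 < y -> log2 (x * y) = log2 x + log2 y.
Proof. by move=> x0 y0; rewrite /log2 ln_mult //; lra. Qed.

Lemma log2_pow (a : nat) : log2 (2 ^ a) = INR a.
Proof.
have := ln2_gt0; rewrite /log2 ln_pow; last lra.
by move=> h; field; lra.
Qed.

Lemma expn2_le_log2 (a b : nat) : (expn 2 a <= b)%nat -> INR a <= log2 (INR b).
Proof.
move=> /ssrnat.leP /le_INR; rewrite INR_expn2 -(log2_pow a); apply: log2_le.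
by apply: pow_lt; lra.
Qed.

Lemma up_log_le_log2 (a : nat) : (1 < a)%nat -> INR (up_log 2 a) <= log2 (INR a) + 1.
Proof.
move=> a1; have := up_log_gtn (isT : (1 < 2)%nat) a1.
have : (0 < up_log 2 a)%nat by rewrite up_log_gt0.
case: (up_log 2 a) => // x _ /= /ltnW /expn2_le_log2.
by rewrite -/(INR x.+1) S_INR; lra.
Qed.

Lemma log2_2 : log2 2 = 1.
Proof. by have := log2_pow 1; rewrite pow_1. Qed.

(** From [2 ^ 3 <= 3 * 3] and [2 <= (3 / 2) * (3 / 2)]. *)
Lemma log2_log2_ge_half (n : nat) : (3 <= n)%nat ->
  1 <= log2 (INR n) /\ 1 / 2 <= log2 (log2 (INR n)).
Proof.
have half x y : 0 < x -> 2 ^ y <= x * x -> INR y / 2 <= log2 x.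
  move=> x0 /(log2_le (pow_lt 2 y _)) h; have := h ltac:(lra).
  by rewrite log2_pow log2_mul //; lra.
move=> /ssrnat.leP /le_INR; have -> : INR 3 = 3 by rewrite INR_IZR_INZ.
move=> n3; have : 3 / 2 <= log2 (INR n).
  apply: Rle_trans (_ : log2 3 <= _); last by apply: log2_le; lra.
  by have := half 3 3%nat ltac:(lra); rewrite /=; lra.
move=> h; split; first lra.
have := half (log2 (INR n)) 1%nat ltac:(lra); rewrite /=; nra.
Qed.

(** The number of rows is at most [loglog n + 2], and [loglog n >= 1 / 2] absorbs the constant. *)
Lemma level_count_le (n c : nat) : (3 <= n)%nat ->
  INR (level_count n c) <= 5 * log2 (log2 (INR n)) * 2 ^ c.
Proof.
move=> n3; have [l1 ll] := log2_log2_ge_half n3.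
rewrite /level_count mult_INR INR_expn2; apply: Rmult_le_compat_r.
  by apply: pow_le; lra.
have x0 : (0 < up_log 2 n)%nat by rewrite up_log_gt0 /=; lia.
have le_x : INR (up_log 2 n) <= 2 * log2 (INR n).
  by apply: Rle_trans (up_log_le_log2 _) _; [lia | lra].
have /andP [/expn2_le_log2 le_i _] := trunc_log_bounds (isT : (1 < 2)%nat) x0.
have := log2_le (lt_0_INR _ (elimT ssrnat.ltP x0)) le_x.
rewrite log2_mul; [|lra|lra].
by rewrite log2_2 S_INR; lra.
Qed.

(** With [u = r * t] and [l = log2 s], the least admissible choices satisfy [kappa <= 5 + l] and
    [2 ^ c <= 240 * u * l]. The required average degree is then at most [230400 * u ^ 2 * l * ll],
    which is below [s * ll]. *)
Lemma has_almost_regular_of_avg_deg (T : finType) (E : rel T) (t r : nat) :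
  simple_graph E -> (3 <= #|T|)%nat -> (0 < t)%nat -> (0 < r)%nat ->
  ~ contains_Ktt E t ->
  let ll := log2 (log2 (INR #|T|)) in
  let s := avg_deg [set: T] E / ll in
  2 <= s -> 250000 * (INR r * INR t * log2 s) ^ 2 <= s ->
  has_almost_regular E (8 * r).
Proof.
move=> simE n3 t0 r0 noK ll s s2 hs.
have [_ ll2] := log2_log2_ge_half n3; rewrite -/ll in ll2.
have n0 : 0 < INR #|T| by apply: lt_0_INR; apply/ssrnat.ltP; lia.
set l := log2 s in hs.
have l1 : 1 <= l by rewrite -log2_2; apply: log2_le; lra.
set u := INR r * INR t in hs.
have ge1 a : (0 < a)%nat -> 1 <= INR a.
  by move=> /ssrnat.leP /le_INR.
have u1 : 1 <= u by have := ge1 r r0; have := ge1 t t0; rewrite /u; nra.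
have ul : u <= u * l by nra.
have us : u <= s by nra.
have lu : log2 u <= l by apply: log2_le; lra.
pose kappa := up_log 2 (12 * r * t).
pose c := up_log 2 (8 * t * r * (2 * kappa + 3)).
have INRc (x : nat) (y : R) : IZR (Z.of_nat x) = y -> INR x = y.
  by rewrite INR_IZR_INZ.
have kap : INR kappa <= 5 + l.
  have := @up_log_le_log2 (12 * r * t) ltac:(nia); rewrite -/kappa.
  have -> : INR (12 * r * t) = 12 * u.
    by rewrite !mult_INR (INRc 12%nat 12) // /u; ring.
  have := @log2_le (12 * u) (2 ^ 4 * u) ltac:(lra) ltac:(lra).
  rewrite (@log2_mul (2 ^ 4)); [|lra|lra]; rewrite log2_pow (INRc 4%nat 4) //; lra.
have two_c : 2 ^ c <= 16 * u * (15 * l).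
  have arg1 : (1 < 8 * t * r * (2 * kappa + 3))%nat by nia.
  have := up_log_gtn (isT : (1 < 2)%nat) arg1.
  have : (0 < c)%nat by rewrite up_log_gt0.
  rewrite -/c; case: (c) => // c' _ /= /ltnW /ssrnat.leP /le_INR.
  rewrite INR_expn2 !mult_INR plus_INR mult_INR.
  rewrite (INRc 8%nat 8) // (INRc 2%nat 2) // (INRc 3%nat 3) //.
  have -> : 8 * INR t * INR r = 8 * u by rewrite /u; ring.
  by nra.
apply: (@has_almost_regular_of_sum_sdeg T E t r kappa c) => //.
- exact: up_logP.
- exact: up_logP.
have [symE irrE] := simE.
rewrite sum_sdegE sum_rel_nedges //; apply/ssrnat.ltP/INR_lt.
have cnt := level_count_le c n3; rewrite -/ll in cnt.
set lc := level_count #|T| c in cnt *; clearbody lc.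
rewrite !mult_INR (INRc 4%nat 4) // (INRc 12%nat 12) // (INRc 2%nat 2) //.
have -> : 2 * INR (nedges E) = s * ll * INR #|T|.
  by rewrite /s /avg_deg cardsT; field; lra.
apply: Rmult_lt_compat_r => //.
have -> : 12 * INR r * INR t = 12 * u by rewrite /u; ring.
apply: Rle_lt_trans (_ : 192 * u * (5 * ll * (16 * u * (15 * l))) < _).
  have -> : forall x, 4 * (4 * (12 * u) * x) = 192 * u * x by move=> x; ring.
  apply: Rmult_le_compat_l; first lra.
  apply: Rle_trans cnt _; apply: Rmult_le_compat_l; first lra.
  exact: two_c.
have -> : 192 * u * (5 * ll * (16 * u * (15 * l))) = 230400 * (u * u * l) * ll by ring.
apply: Rmult_lt_compat_r; first lra.
by nra.
Qed.

Lemma nat_floor (x : R) : 0 <= x -> exists a : nat, INR a <= x < INR a + 1.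
Proof.
move=> x0; have [h1 h2] := base_Int_part x.
have z0 : (0 <= Int_part x)%Z.
  have : (-1 < Int_part x)%Z by apply: lt_IZR; lra.
  by lia.
exists (Z.to_nat (Int_part x)); rewrite INR_IZR_INZ Z2Nat.id //; lra.
Qed.

(** A single edge settles the cases where the integer parameter rounds down to 0. *)
Lemma contains_K11 (T : finType) (E : rel T) (S : {set T}) :
  irreflexive E -> 0 < avg_deg S E -> contains_Ktt E 1.
Proof.
move=> irrE avg; have : (0 < nedges E)%nat.
  rewrite lt0n; apply/eqP => e0; move: avg.
  by rewrite /avg_deg e0 Rmult_0_r /Rdiv Rmult_0_l; lra.
rewrite card_gt0 => /set0Pn [A]; rewrite inE.
move=> /existsP [x /existsP [y /andP [Exy _]]].
exists [set x], [set y]; rewrite !cards1; do 2 split=> //; split.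
  by rewrite disjoints1 inE; apply: contraTneq Exy => ->; rewrite irrE.
by move=> a b; rewrite !inE => /eqP -> /eqP ->.
Qed.

End Asymptotics.

(** * Choice of [t] and [r] for the two bounds *)

Theorem theorem6p4 :
  (exists eps : R, (0 < eps)%R /\
    forall (T : finType) (E : rel T), simple_graph E ->
      3 <= #|T| ->
      let n := INR #|T| in
      let d := avg_deg [set: T] E in
      (2 * log2 (log2 n) <= d)%R ->
      exists (S : {set T}) (F : rel T),
        S != set0 /\ is_subgraph E S F /\ almost_regular 64 S F /\
        (eps * Rpower (d / log2 (log2 n)) (1/4)
           / Rpower (log2 (d / log2 (log2 n))) (1/2) <= avg_deg S F)%R)
  /\
  (forall t : nat, 0 < t ->
    exists eps : R, (0 < eps)%R /\
    forall (T : finType) (E : rel T), simple_graph E ->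
      3 <= #|T| ->
      ~ contains_Ktt E t ->
      let n := INR #|T| in
      let d := avg_deg [set: T] E in
      (2 * log2 (log2 n) <= d)%R ->
      exists (S : {set T}) (F : rel T),
        S != set0 /\ is_subgraph E S F /\ almost_regular 64 S F /\
        (eps * Rpower (d / log2 (log2 n)) (1/2)
           / log2 (d / log2 (log2 n)) <= avg_deg S F)%R).
Proof.
Local Open Scope R_scope.
have s_ge2 (T : finType) (E : rel T) : (3 <= #|T|)%nat ->
    2 * log2 (log2 (INR #|T|)) <= avg_deg [set: T] E ->
    2 <= avg_deg [set: T] E / log2 (log2 (INR #|T|)) /\ 0 < avg_deg [set: T] E.
  move=> n3 hd; have [_ ll] := log2_log2_ge_half n3; split; last lra.
  apply: (Rmult_le_reg_r (log2 (log2 (INR #|T|)))); first lra.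
  by rewrite /Rdiv Rmult_assoc Rinv_l; lra.
have finish (T : finType) (E : rel T) q x : irreflexive E ->
    has_almost_regular E q -> x <= INR q / 64 ->
    exists (S : {set T}) (F : rel T), S != set0 /\ is_subgraph E S F /\
      almost_regular 64 S F /\ x <= avg_deg S F.
  move=> irrE /(has_almost_regular_avg_deg irrE) [S [F [S0 [sub [areg le]]]]] hx.
  by exists S, F; do 3 split=> //; exact: Rle_trans hx le.
have half x y : 0 < x -> Rpower x y = Rpower x (y / 2) * Rpower x (y / 2).
  by move=> x0; rewrite -Rpower_plus; congr Rpower; lra.
have INR64 : INR 64 = 64 by rewrite INR_IZR_INZ.
split.
  exists (/ 128); split; first lra.
  move=> T E simE n3 n d hd; have [symE irrE] := simE.
  have [s2 d0] := s_ge2 T E n3 hd; rewrite -/n -/d in s2 d0 *.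
  set s := d / log2 (log2 n) in s2 *; set l := log2 s.
  have l1 : 1 <= l by rewrite -log2_2; apply: log2_le; lra.
  set a := Rpower s (1 / 4); set b := Rpower l (1 / 2).
  have a0 : 0 < a by exact: exp_pos.
  have b0 : 0 < b by exact: exp_pos.
  have a4 : (a * a) * (a * a) = s.
    have -> : a * a = Rpower s (1 / 2).
      by rewrite (half s (1 / 2)); [congr (_ * _); rewrite /a; congr Rpower; lra | lra].
    by rewrite -half; [apply: Rpower_1; lra | lra].
  have b2 : b * b = l by rewrite -half; [apply: Rpower_1; lra | lra].
  (* The target is [x / 2]. With [t] the integer part of [x], either [t = 0] and one edge suffices,
     or [x < t + 1 <= 2 * t]. *)
  pose x := a / b / 64.
  have x0 : 0 < x by apply: Rdiv_lt_0_compat; [apply: Rdiv_lt_0_compat | lra].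
  have -> : / 128 * a / b = x / 2 by rewrite /x; field; lra.
  have [t [tx xt]] := nat_floor (Rlt_le _ _ x0).
  have [t0|t0] := posnP t.
    have K11 := contains_K11 irrE d0.
    apply: (finish _ _ _ _ irrE (has_almost_regular_Ktt symE (isT : (0 < 1)%nat) K11)).
    by rewrite INR64; move: xt; rewrite t0 /=; lra.
  have t1 : 1 <= INR t by move: t0 => /ssrnat.leP /le_INR.
  apply: (finish _ _ (64 * t)%nat _ irrE); last by rewrite mult_INR INR64; lra.
  (* A copy of [K_{t,t}] is regular of degree [t]; without one, [r = 8 * t] gives the same bound. *)
  have [K|noK] := Classical_Prop.classic (contains_Ktt E t).
    exact: has_almost_regular_Ktt.
  have -> : (64 * t = 8 * (8 * t))%nat by lia.
  apply: has_almost_regular_of_avg_deg noK _ _ => //; first by lia.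
  rewrite -/n -/d -/s -/l mult_INR (_ : INR 8 = 8); last by rewrite INR_IZR_INZ.
  (* Its fourth power gives the size condition, since [250000 * 8 ^ 2 = 16000000] is below
     [64 ^ 4 = 16777216]. *)
  have tb : INR t * b <= a / 64.
    have -> : a / 64 = x * b by rewrite /x; field; lra.
    by apply: Rmult_le_compat_r; lra.
  have tb2 : (INR t * b) * (INR t * b) <= (a / 64) * (a / 64).
    by apply: Rmult_le_compat; nra.
  have tb4 : ((INR t * b) * (INR t * b)) * ((INR t * b) * (INR t * b)) <=
      ((a / 64) * (a / 64)) * ((a / 64) * (a / 64)).
    by apply: Rmult_le_compat; nra.
  have -> : 250000 * (8 * INR t * INR t * l) ^ 2 =
      16000000 * (((INR t * b) * (INR t * b)) * ((INR t * b) * (INR t * b))).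
    by rewrite -b2; ring.
  have : ((a / 64) * (a / 64)) * ((a / 64) * (a / 64)) = s / 16777216.
    by rewrite -a4; field.
  by lra.
move=> t t0; have t1 : 1 <= INR t by move: t0 => /ssrnat.leP /le_INR.
exists (/ (8000 * INR t)); split; first by apply: Rinv_0_lt_compat; lra.
move=> T E simE n3 noK n d hd; have [symE irrE] := simE.
have [s2 d0] := s_ge2 T E n3 hd; rewrite -/n -/d in s2 d0 *.
set s := d / log2 (log2 n) in s2 *; set l := log2 s.
have l1 : 1 <= l by rewrite -log2_2; apply: log2_le; lra.
set a := Rpower s (1 / 2).
have a0 : 0 < a by exact: exp_pos.
have a2 : a * a = s by rewrite -half; [apply: Rpower_1; lra | lra].
(* Here [500 ^ 2 = 250000] matches the size condition for [r], the integer part of [x]. The target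
   [x / 16] is at most [r / 8] once [r >= 1]. *)
pose x := a / l / (500 * INR t).
have x0 : 0 < x by apply: Rdiv_lt_0_compat; [apply: Rdiv_lt_0_compat | ]; lra.
have -> : / (8000 * INR t) * a / l = x / 16 by rewrite /x; field; lra.
have [r [rx xr]] := nat_floor (Rlt_le _ _ x0).
have [r0|r0] := posnP r.
  have K11 := contains_K11 irrE d0.
  apply: (finish _ _ _ _ irrE (has_almost_regular_Ktt symE (isT : (0 < 1)%nat) K11)).
  by rewrite INR64; move: xr; rewrite r0 /=; lra.
have r1 : 1 <= INR r by move: r0 => /ssrnat.leP /le_INR.
apply: (finish _ _ (8 * r)%nat _ irrE); last first.
  by rewrite mult_INR (_ : INR 8 = 8); [lra | rewrite INR_IZR_INZ].
apply: has_almost_regular_of_avg_deg noK _ _ => //.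
rewrite -/n -/d -/s -/l.
have rtl : INR r * INR t * l <= a / 500.
  have -> : a / 500 = x * (INR t * l) by rewrite /x; field; lra.
  by rewrite Rmult_assoc; apply: Rmult_le_compat_r; [nra | lra].
have := Rmult_le_compat _ _ _ _ _ _ rtl rtl.
have rtl0 : 0 <= INR r * INR t * l by apply: Rmult_le_pos; nra.
move=> /(_ rtl0 rtl0); rewrite /= Rmult_1_r.
have -> : a / 500 * (a / 500) = s / 250000 by rewrite -a2; field.
by lra.
Qed.
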